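(* For all integers $k, d\geq 1$ there exists $c=c(k,d)$ such that for every integer $n\geq 1$ there is a graph $G$ with $cn$ vertices and maximum degree $c$, such that for all graphs $H_1$ and $H_2$ with $n$ vertices, maximum degree $d$ and treewidth $k$, every red/blue-colouring of the edges of $G$ contains a red copy of $H_1$ or a blue copy of $H_2$.
   Context: Graphs are finite and simple. A red (blue) copy of $H$ in an edge-coloured graph $G$ is a (not necessarily induced) subgraph of $G$ isomorphic to $H$ all of whose edges are red (blue). The treewidth of a graph $G$ is the minimum integer $w$ such that $G$ is a subgraph of a chordal graph with no $(w+2)$-clique. *)

(* Defs.v *)
From mathcomp Require Import all_boot.
From mathcomp Require Import boolp.

Set Implicit Arguments.
Unset Strict Implicit.
Unset Printing Implicit Defensive.

Record sgraph := SGraph {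
  vertex :> finType;
  edge : rel vertex;
  edge_sym : symmetric edge;
  edge_irrefl : irreflexive edge
}.

Definition degree (G : sgraph) (x : G) : nat := #|[set y | edge x y]|.

Definition max_degree (G : sgraph) : nat := \max_(x : G) degree x.

Definition clique (G : sgraph) (K : {set G}) : Prop :=
  {in K &, forall x y, x != y -> edge x y}.

Definition chordal (G : sgraph) : Prop :=
  forall s : seq G, ucycle (@edge G) s -> 4 <= size s ->
  exists x y : G, [/\ x \in s, y \in s, edge x y, next s x != y & next s y != x].

(* The map f is an isomorphism from H onto the subgraph of G with vertex set
   f(V(H)) and edge set {f(x)f(y) : xy in E(H)}. *)
Definition embedding (H G : sgraph) (f : H -> G) : Prop :=
  injective f /\ forall x y : H, edge x y -> edge (f x) (f y).

Definition subgraph (H G : sgraph) : Prop := exists f : H -> G, embedding f.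

(* The chordal supergraph may have more vertices than G. *)
Definition chordal_supergraph (G : sgraph) (w : nat) : Prop :=
  exists Q : sgraph, [/\ chordal Q, forall K : {set Q}, clique K -> #|K| != w.+2
                       & subgraph G Q].

Fact neq_sym (T : eqType) : symmetric (fun x y : T => x != y).
Proof. by move=> x y; rewrite eq_sym. Qed.

Fact neq_irrefl (T : eqType) : irreflexive (fun x y : T => x != y).
Proof. by move=> x; rewrite eqxx. Qed.

Definition complete_graph (T : finType) : sgraph :=
  SGraph (@neq_sym T) (@neq_irrefl T).

Fact complete_chordal (T : finType) : chordal (complete_graph T).
Proof.
case=> [|a [|b [|c [|d s]]]] //= /andP[_ /andP[anin /andP[bnin /andP[cnin _]]]] _.
move: anin bnin cnin; rewrite !inE !negb_or.
move=> /and4P[nab nac nad nas] /and3P[nbc nbd nbs] /andP[ncd ncs].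
exists a, c; split; rewrite ?inE ?eqxx ?orbT //=; rewrite ?eqxx //.
have [eca|_] := eqVneq c a; first by rewrite eca eqxx in nac.
have [ecb|_] := eqVneq c b; first by rewrite ecb eqxx in nbc.
by rewrite eq_sym.
Qed.

Fact chordal_supergraph_ex (G : sgraph) :
  exists w, `[< chordal_supergraph G w >].
Proof.
exists #|G|; apply/asboolP; exists (complete_graph G); split.
- exact: complete_chordal.
- move=> K _; rewrite neq_ltn ltnS; apply/orP; left.
  exact: leqW (max_card (mem K)).
- exists id; split=> // x y; apply: contraTneq => ->.
  by rewrite edge_irrefl.
Qed.

(* The empty graph gets treewidth 0 rather than -1. *)
Definition treewidth (G : sgraph) : nat := ex_minn (chordal_supergraph_ex G).

Inductive colour := Red | Blue.

(* An edge xy is the set [set x; y]; the values of a colouring at sets that are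
   not edges are never used. *)
Definition colouring (G : sgraph) : Type := {set G} -> colour.

Definition has_mono_copy (G : sgraph) (chi : colouring G) (a : colour)
    (H : sgraph) : Prop :=
  exists2 f : H -> G, embedding f &
    forall x y : H, edge x y -> chi [set f x; f y] = a.

(* Main.v *)
Require Import Defs.
From mathcomp Require Import all_boot.
From mathcomp Require Import boolp zify.

(* A graph H of treewidth at most k and maximum degree at most d has a tree
   partition: its vertices are distributed over bounded bags indexed by the nodes
   of a tree of bounded degree, each edge lying inside a bag or between adjacent
   bags (Ding-Oporowski, Wood).  The host graph is a blow-up, by large cliques, of
   the third power of a sparse graph J on O(n) vertices in which any two disjoint
   sets of linear size are joined by an edge.  Given a colouring, Ramsey's theorem
   inside the blown-up vertices and edges leaves a colouring of the vertices and
   edges of J^3.  Let b be the more frequent vertex colour and W its class.  Either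
   the b-coloured edges of J^3 on W contain the tree of the first graph, and its
   bags can be placed into monochromatic cliques; or, by the Friedman-Pippenger
   theorem applied repeatedly, W contains many large sets without b-coloured edges
   between them.  Stars of J with one leaf in each of these sets then act as
   blown-up vertices in the other colour, and another application of the
   Friedman-Pippenger theorem, in J, embeds the tree of the second graph. *)

Set Implicit Arguments.
Unset Strict Implicit.
Unset Printing Implicit Defensive.

(** * Friedman-Pippenger tree embedding *)

(** All cliques blown up over [W] have the majority colour [b], so the other colour has to be found
    between different vertices. A missing tree in colour [b] yields sets between which every near
    pair has the other colour, but nothing is known about pairs inside one of these sets. A bag is
    therefore spread over the leaves of one star, one vertex per leaf, and adjacent bags must use
    leaves in different sets. For bags of size at most [p] this takes [2p] sets: the parity of the
    depth in the tree decides which half of them a bag uses. Leaves of adjacent stars are joined by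
    the walk leaf, centre, centre, leaf, whence the third power. The pairs of colour [b] are chosen
    by an adversary and need not expand, so on [W] there is only a dichotomy between a tree and a
    hole. The centres of the stars are embedded by J itself, where holes are excluded and the same
    dichotomy always gives the tree. *)

Ltac card_lia :=
  repeat match goal with
  | |- context [card ?A] => let c := fresh "c" in set c := card A; move: c
  | |- context [@bigop.body nat ?I ?z ?r ?F] =>
      let c := fresh "c" in set c := @bigop.body nat I z r F; move: c
  end; clear; intros; lia.

Section Nbh.
Variables (V : finType) (r : rel V).

Definition nbh (W X : {set V}) : {set V} := [set y in W | [exists x in X, r x y]].

Lemma nbhP (W X : {set V}) y :
  reflect (y \in W /\ exists2 x, x \in X & r x y) (y \in nbh W X).
Proof.
rewrite inE; apply: (iffP andP) => [[yW /exists_inP[x xX rxy]]|[yW [x xX rxy]]].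
  by split=> //; exists x.
by split=> //; apply/exists_inP; exists x.
Qed.

Lemma nbhU (W X Y : {set V}) : nbh W (X :|: Y) = nbh W X :|: nbh W Y.
Proof.
apply/setP=> y; rewrite in_setU; apply/nbhP/orP.
  case=> yW [x]; rewrite in_setU => /orP[xX|xY] rxy; [left|right];
  by apply/nbhP; split=> //; exists x.
by case=> /nbhP[yW [x xX rxy]]; split=> //; exists x => //; rewrite in_setU xX ?orbT.
Qed.

Lemma nbhS (W X Y : {set V}) : X \subset Y -> nbh W X \subset nbh W Y.
Proof. by move=> /setUidPr <-; rewrite nbhU subsetUl. Qed.

Lemma nbh_sub (W X : {set V}) : nbh W X \subset W.
Proof. by apply/subsetP=> y /nbhP[]. Qed.

(* Hall-type condition: the vertices x of X can still be given b x new neighbours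
   each, disjointly and outside the set S of used vertices. *)
Definition has_room (W S : {set V}) (b : V -> nat) (l : nat) : Prop :=
  forall X : {set V}, X \subset W -> #|X| <= l ->
  \sum_(x in X) b x <= #|nbh W X :\: S|.

(** Sets that avoid [v] and attain equality in [has_room] are critical. They have at most [n]
    elements, so the union of two of them is still in the range [n.*2] of the condition and is again
    critical. A neighbour [y] of [v] outside the neighbourhood of a largest critical set [Z] works:
    a set spoiled by the use of [y] would be critical, hence contained in [Z], and yet have [y] as a
    neighbour. *)
Lemma has_room_extend (W S : {set V}) (b : V -> nat) (D n : nat) (v : V) :
  0 < n -> #|S| <= n -> (forall x, b x <= D) ->
  (forall X : {set V}, X \subset W -> X != set0 -> #|X| <= n.*2 ->
     D.+1 * #|X| <= #|nbh W X|) ->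
  has_room W S b n.*2 -> v \in W -> 0 < b v ->
  exists y, [/\ y \in W, y \notin S, r v y &
    has_room W (y |: S) (fun x => b x - (x == v)) n.*2].
Proof.
move=> n0 Sn bD expand room vW bv.
pose crit (X : {set V}) := [&& X \subset W, #|X| <= n.*2, v \notin X &
  \sum_(x in X) b x == #|nbh W X :\: S|].
have nbh0 : nbh W set0 = set0.
  by apply/setP=> y; rewrite in_set0; apply/negP => /nbhP[_ [x]]; rewrite in_set0.
have crit0 : crit set0 by rewrite /crit sub0set cards0 in_set0 big_set0 nbh0 set0D cards0.
(* The expansion [D.+1] exceeds the demand, at most [D] per vertex, by [#|X|] in total; only the at
   most [n] vertices of [S] can absorb this surplus. *)
have crit_small X : crit X -> #|X| <= n.
  move=> /and4P[XW X2 _ /eqP eqX]; have [->|Xn0] := eqVneq X set0; first by rewrite cards0.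
  have sumD : \sum_(x in X) b x <= D * #|X|.
    by rewrite mulnC -sum_nat_const; apply: leq_sum => x _; exact: bD.
  have := expand X XW Xn0 X2.
  have := cardsID S (nbh W X); have := subset_leq_card (subsetIr (nbh W X) S).
  move: Sn sumD; rewrite eqX.
  card_lia.
case: (arg_maxnP (fun X : {set V} => #|X|) crit0) => Z critZ maxZ.
have /and4P[ZW Z2 vZ /eqP eqZ] := critZ.
have Zn := crit_small Z critZ.
case: (pickP (fun y => [&& y \in W, y \notin S, r v y & y \notin nbh W Z])); last first.
  move=> none; exfalso.
  have vZ2 : #|v |: Z| <= n.*2 by rewrite cardsU1 vZ; move: n0 Zn; card_lia.
  have vZW : v |: Z \subset W by rewrite subUset sub1set vW.
  have := room _ vZW vZ2; rewrite big_setU1 //= eqZ.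
  suff -> : nbh W (v |: Z) :\: S = nbh W Z :\: S by move: bv; card_lia.
  apply/setP=> y; rewrite !in_setD nbhU in_setU; case: (boolP (y \in S)) => //= yS.
  case: (boolP (y \in nbh W Z)) => [|yZ]; first by rewrite orbT.
  rewrite orbF; apply/negP => /nbhP[yW [x]]; rewrite in_set1 => /eqP-> rvy.
  by have := none y; rewrite yW yS rvy yZ.
move=> y /and4P[yW yS rvy yZ]; exists y; split=> // X XW X2.
have roomX := room X XW X2.
have cardD : #|nbh W X :\: S| = (y \in nbh W X) + #|nbh W X :\: (y |: S)|.
  rewrite (cardsD1 y) in_setD yS /=; congr (_ + _); apply: eq_card => z.
  by rewrite !inE negb_or andbA.
have sum_le : \sum_(x in X) (b x - (x == v)) + (v \in X) <= \sum_(x in X) b x.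
  case: (boolP (v \in X)) => vX; last first.
    by rewrite addn0; apply: leq_sum => x _; apply: leq_subr.
  rewrite (big_setD1 v vX) /= [X in _ <= X](big_setD1 v vX) /= eqxx.
  rewrite addnAC leq_add ?subnK //.
  by apply: leq_sum => x _; apply: leq_subr.
case: (boolP (\sum_(x in X) (b x - (x == v)) <= #|nbh W X :\: (y |: S)|)) => // bad.
exfalso.
have [yX [vX eqX]] : y \in nbh W X /\ (v \notin X) /\
    \sum_(x in X) b x = #|nbh W X :\: S|.
  move: bad sum_le roomX cardD.
  by case: (y \in nbh W X); case: (v \in X) => /=; card_lia.
have critX : crit X by rewrite /crit XW X2 vX eqX eqxx.
have Xn := crit_small X critX.
have UW : X :|: Z \subset W by rewrite subUset XW.
have U2 : #|X :|: Z| <= n.*2.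
  by rewrite -addnn (leq_trans (leq_card_setU X Z)) ?leq_add.
have IW : X :&: Z \subset W by apply: subset_trans ZW; exact: subsetIr.
have I2 : #|X :&: Z| <= n.*2.
  by apply: leq_trans Z2; rewrite subset_leq_card ?subsetIr.
(* Submodularity of X |-> #|N(X) - S| makes the critical sets closed under union. *)
have submod : #|nbh W (X :|: Z) :\: S| + #|nbh W (X :&: Z) :\: S| <=
    #|nbh W X :\: S| + #|nbh W Z :\: S|.
  rewrite -[X in _ <= X]cardsUI nbhU setDUl leq_add2l; apply: subset_leq_card.
  by rewrite subsetI !setSD // nbhS ?subsetIl ?subsetIr.
have summod : \sum_(x in X :|: Z) b x + \sum_(x in X :&: Z) b x =
    \sum_(x in X) b x + \sum_(x in Z) b x.
  rewrite (bigID (mem X)) /= [X in _ = _ + X](bigID (mem X)) /=.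
  have e1 : \sum_(i in X :|: Z | i \in X) b i = \sum_(i in X) b i.
    by apply: eq_bigl => i; rewrite in_setU; case: (i \in X); rewrite ?andbT ?andbF.
  have e2 : \sum_(i in X :|: Z | i \notin X) b i = \sum_(i in Z | i \notin X) b i.
    by apply: eq_bigl => i; rewrite in_setU; case: (i \in X); rewrite ?andbT ?andbF.
  have e3 : \sum_(i in X :&: Z) b i = \sum_(i in Z | i \in X) b i.
    by apply: eq_bigl => i; rewrite in_setI andbC.
  have e4 : \sum_(i in X) b i = \sum_(i in X | i \in Z) b i + \sum_(i in X | i \notin Z) b i.
    by rewrite (bigID (mem Z)).
  by rewrite e1 e2 e3 e4 -addnA; congr addn; rewrite addnC.
have critU : crit (X :|: Z).
  rewrite /crit UW U2 in_setU negb_or vX vZ /=.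
  move: (room _ UW U2) (room _ IW I2) submod summod; rewrite eqX eqZ.
  card_lia.
have /eqP UZ : Z == X :|: Z by rewrite eqEcard subsetUr; exact: maxZ.
by move: yZ; rewrite UZ nbhU in_setU yX.
Qed.
End Nbh.

(* A rooted tree on the nodes 0, ..., t-1 with root 0 is given by the parent
   function of its other nodes. *)
Definition nchildren (par : nat -> nat) (t i : nat) : nat :=
  \sum_(1 <= j < t) (par j == i).

Definition rooted_tree (par : nat -> nat) (t D : nat) : Prop :=
  (forall i, 0 < i < t -> par i < i) /\ (forall i, i < t -> nchildren par t i <= D).

Definition tree_copy (V : finType) (r : rel V) (W : {set V}) (par : nat -> nat)
    (t : nat) (f : nat -> V) : Prop :=
  [/\ forall i, i < t -> f i \in W,
      forall i j, i < t -> j < t -> f i = f j -> i = j &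
      forall i, 0 < i < t -> r (f (par i)) (f i)].

Definition hole (V : finType) (r : rel V) (m : nat) (A B : {set V}) : Prop :=
  [/\ m <= #|A|, m <= #|B|, [disjoint A & B] & {in A & B, forall x y, ~~ r x y}].

Lemma nchildrenS par t i :
  0 < t -> nchildren par t.+1 i = nchildren par t i + (par t == i).
Proof. by move=> t0; rewrite /nchildren big_nat_recr. Qed.

Lemma nchildren_le par s t i : s <= t -> nchildren par s i <= nchildren par t i.
Proof.
elim: t => [|t IH]; first by rewrite leqn0 => /eqP->.
rewrite leq_eqVlt => /orP[/eqP->//|st]; apply: leq_trans (IH st) _.
case: t {st IH} => [|t]; first by rewrite /nchildren !big_geq.
by rewrite [nchildren _ t.+2 _]nchildrenS // leq_addr.
Qed.

Section TreeEmbedding.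
Variables (V : finType) (r : rel V).

(** Nodes are embedded in the order of their indices. The budget [b x] is the number of children
    that [x] may still receive; budget plus children already placed is kept at [D] or more, so a
    node whose next child is due has positive budget. *)
Lemma expanding_tree_copy (W : {set V}) (par : nat -> nat) (t D n : nat) :
  0 < t -> t <= n -> rooted_tree par t D -> W != set0 ->
  (forall X : {set V}, X \subset W -> X != set0 -> #|X| <= n.*2 ->
     D.+1 * #|X| <= #|nbh r W X|) ->
  exists f, tree_copy r W par t f.
Proof.
move=> t0 tn [par_lt chD] /set0Pn[v0 v0W] expand.
have n0 : 0 < n by apply: leq_trans tn.
suff: forall s, 0 < s <= t -> exists f b,
    [/\ tree_copy r W par s f, forall x, b x <= D,
      has_room r W [set f (val i) | i in 'I_s] b n.*2 &
      forall x, D <= b x + \sum_(1 <= j < s) (f (par j) == x)].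
  by move=> /(_ t); rewrite t0 leqnn => /(_ isT)[f [b [ft _ _ _]]]; exists f.
elim=> // s IH; case: s IH => [_ _|s IH /andP[_ st]].
  exists (fun=> v0), (fun=> D); split=> //.
  - by split=> // [[|i] [|j]|[|i]].
  - move=> X XW X2; have [->|Xn0] := eqVneq X set0; first by rewrite big_set0.
    rewrite sum_nat_const; have := expand X XW Xn0 X2.
    set S := [set _ | _ in _]; have S1 : #|S| <= 1.
      by rewrite (leq_trans (leq_imset_card _ _)) // card_ord.
    move: Xn0; rewrite -card_gt0; have := cardsID S (nbh r W X).
    move: S1; have := subset_leq_card (subsetIr (nbh r W X) S).
    by card_lia.
  by move=> x; rewrite leq_addr.
have [|f [b [[fW finj fe] bD room cap]]] := IH; first by rewrite /= ltnW.
have ps : par s.+1 < s.+1 by apply: par_lt.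
have vW := fW _ ps.
have bv : 0 < b (f (par s.+1)).
  have := cap (f (par s.+1)); have := chD _ (ltn_trans ps st).
  have := nchildren_le par (par s.+1) st; rewrite nchildrenS // eqxx.
  have -> : \sum_(1 <= j < s.+1) (f (par j) == f (par s.+1)) =
            nchildren par s.+1 (par s.+1).
    rewrite /nchildren; apply: eq_big_nat => j /andP[j0 js]; congr nat_of_bool.
    have pj : par j < s.+1.
      by apply: ltn_trans (par_lt j _) (js); rewrite j0; apply: ltn_trans (js) (st).
    by apply/eqP/eqP => [/(finj _ _ pj ps)|->].
  by card_lia.
have Sn : #|[set f (val i) | i in 'I_s.+1]| <= n.
  rewrite (leq_trans (leq_imset_card _ _)) // card_ord.
  by apply: leq_trans tn; apply: ltnW.
have [y [yW yS rvy room']] := has_room_extend n0 Sn bD expand room vW bv.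
have fy i : i < s.+1 -> f i <> y.
  move=> si fiy; move: yS; rewrite -fiy => /negP; apply.
  by apply/imsetP; exists (Ordinal si).
exists (fun i => if i == s.+1 then y else f i), (fun x => b x - (x == f (par s.+1))).
have par_ltS i : 0 < i < s.+2 -> par i < s.+1.
  move=> /andP[i0 si]; apply: leq_trans (par_lt i _) (si).
  by rewrite i0; apply: leq_trans si st.
split.
- split.
  + by move=> i; rewrite ltnS leq_eqVlt; case: eqP => //= _; apply: fW.
  + move=> i j; rewrite ltnS leq_eqVlt; case: eqP => [->|_] /= si.
      rewrite ltnS leq_eqVlt; case: eqP => [->//|_] /= sj yf.
      by case: (fy j sj).
    rewrite ltnS leq_eqVlt; case: eqP => [->//|_] /= sj; first by move/(fy i si).
    exact: finj.
  + move=> i iS; rewrite (ltn_eqF (par_ltS i iS)); move: iS => /andP[i0].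
    by rewrite ltnS leq_eqVlt; case: eqP => [->//|_] /= si; rewrite fe ?i0.
- by move=> x; apply: leq_trans (leq_subr _ _) (bD x).
- suff -> : [set (if val i == s.+1 then y else f (val i)) | i in 'I_s.+2] =
            y |: [set f (val i) | i in 'I_s.+1] by [].
  apply/setP=> x; rewrite in_setU1; apply/imsetP/orP.
    case=> i _ ->; case: (val i =P s.+1) => [_|/eqP ni]; first by left.
    right; have si : i < s.+1 by rewrite ltn_neqAle ni -ltnS /=.
    by apply/imsetP; exists (Ordinal si).
  case=> [/eqP->|/imsetP[i _ ->]]; first by exists ord_max; rewrite //= eqxx.
  by exists (widen_ord (leqnSn _) i) => //=; rewrite ltn_eqF.
move=> x; rewrite (eq_big_nat _ _ (F2 := fun j => (f (par j) == x) : nat)); last first.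
  by move=> j jS; rewrite (ltn_eqF (par_ltS j jS)).
rewrite big_nat_recr //= (eq_sym x); have := cap x; move: bv.
by case: eqP => [<-|_] /=; card_lia.
Qed.

(* Deleting a maximal small set with too few neighbours leaves an expanding set. *)
Lemma hole_or_tree_copy (W : {set V}) (par : nat -> nat) (t D m n : nat) :
  0 < t -> t <= n -> n.*2 <= m -> rooted_tree par t D ->
  (D.*2 + 6) * m <= #|W| ->
  (exists f, tree_copy r W par t f) \/
  (exists A B : {set V}, [/\ A \subset W, B \subset W & hole r m A B]).
Proof.
move=> t0 tn nm ptree Wbig.
have m0 : 0 < m by lia.
pose small (Z : {set V}) := [&& Z \subset W, #|Z| <= m &
  #|nbh r W Z :\: Z| <= D.+1 * #|Z|].
have nbh0 : nbh r W set0 = set0.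
  by apply/setP=> y; rewrite in_set0; apply/negP => /nbhP[_ [x]]; rewrite in_set0.
have small0 : small set0 by rewrite /small sub0set !cards0 nbh0 set0D cards0.
case: (arg_maxnP (fun X : {set V} => #|X|) small0) => Z /and3P[ZW Zm ZN] maxZ.
have WZ0 : W :\: Z != set0.
  rewrite -card_gt0; have := cardsID Z W; have := subset_leq_card (subsetIr W Z).
  by move: Wbig m0 Zm; card_lia.
have [/existsP[X /and4P[XWZ Xn0 X2 XN]]|/existsPn bad] := boolP [exists X : {set V},
    [&& X \subset W :\: Z, X != set0, #|X| <= n.*2 & #|nbh r (W :\: Z) X| <= D.+1 * #|X|]];
  last first.
  left; have [|f [fW finj fe]] := expanding_tree_copy t0 tn ptree WZ0.
    move=> X XW Xn0 X2; have := bad X; rewrite XW Xn0 X2 /= -ltnNge; exact: ltnW.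
  by exists f; split=> // i /fW; rewrite in_setD => /andP[].
right; have [XW XZ] : X \subset W /\ [disjoint X & Z].
  by move: XWZ; rewrite subsetD => /andP[].
have UW : Z :|: X \subset W by rewrite subUset ZW.
have cU : #|Z :|: X| = #|Z| + #|X|.
  by rewrite cardsU setIC disjoint_setI0 // cards0 subn0.
have NU : #|nbh r W (Z :|: X) :\: (Z :|: X)| <= D.+1 * #|Z :|: X|.
  rewrite cU mulnDr; apply: leq_trans (leq_add ZN XN).
  apply: leq_trans (leq_card_setU _ _); apply: subset_leq_card.
  apply/subsetP=> y; rewrite in_setD nbhU !in_setU negb_or in_setD.
  move=> /andP[/andP[yZ yX] /orP[yN|/nbhP[yW [x xX rxy]]]]; first by rewrite yZ yN.
  by apply/orP; right; apply/nbhP; rewrite in_setD yZ; split=> //; exists x.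
(* Maximality of [Z] forces this, and [#|Z :|: X|] is at most [2m] because [#|X| <= n.*2 <= m].
   Removing this set and its at most [D.+1 * 2m] outer neighbours from [W] leaves at least [2m]
   vertices; this is where [D.*2 + 6] comes from. *)
have Um : m <= #|Z :|: X|.
  rewrite leqNgt; apply/negP => Um.
  have /maxZ : small (Z :|: X) by rewrite /small UW NU (ltnW Um).
  by rewrite /= cU; move: Xn0; rewrite -card_gt0; card_lia.
exists (Z :|: X), (W :\: (Z :|: X) :\: nbh r W (Z :|: X)); split=> //.
  by rewrite setDDl subsetDl.
split=> //.
- have e : W :\: (Z :|: X) :\: nbh r W (Z :|: X) =
    W :\: ((Z :|: X) :|: (nbh r W (Z :|: X) :\: (Z :|: X))).
    apply/setP=> y; rewrite !(in_setD, in_setU).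
    by case: (y \in Z); case: (y \in X); case: (y \in W); case: (y \in nbh _ _ _).
  rewrite e; set Y := _ :|: (_ :\: _); have := cardsID Y W.
  have := subset_leq_card (subsetIr W Y).
  have := (leq_card_setU (Z :|: X) (nbh r W (Z :|: X) :\: (Z :|: X))).1; rewrite -/Y.
  have U2 : #|Z :|: X| <= m.*2 by rewrite cU -addnn leq_add // (leq_trans X2).
  have : D.+1 * #|Z :|: X| <= D.+1 * m.*2 by rewrite leq_mul2l U2 orbT.
  by move: NU Wbig U2 m0; card_lia.
- by rewrite -setI_eq0 -subset0; apply/subsetP=> y; rewrite !inE; case: (y \in Z); case: (y \in X); rewrite ?andbF.
move=> x y xU; rewrite in_setD => /andP[yN]; rewrite in_setD => /andP[_ yW].
by apply: contra yN => rxy; apply/nbhP; split=> //; exists x.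
Qed.
End TreeEmbedding.

(** * Random graphs without holes *)

Lemma subset_of_card (T : finType) (A : {set T}) (m : nat) :
  m <= #|A| -> exists2 B : {set T}, B \subset A & #|B| = m.
Proof.
move=> /card_geqP[s [us <- sA]]; exists [set x in s].
  by apply/subsetP=> x; rewrite inE => /sA.
by rewrite cardsE; apply/card_uniqP.
Qed.

(** Bernoulli's inequality [(1 + 1/j)^r >= 1 + r/j], cleared of denominators. *)
Lemma exp_ratio_unbounded (a j : nat) : exists2 r, 0 < r & a * j ^ r < j.+1 ^ r.
Proof.
have bernoulli r : j ^ r * (j + r) <= j.+1 ^ r * j.
  elim: r => [|r IH]; first by rewrite !expn0 addn0.
  have := leq_mul (leqnn j.+1) IH; rewrite !expnS.
  by move: (j ^ r) (j.+1 ^ r) => u v; nia.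
have [->|j0] := posnP j; first by exists 1; rewrite // muln0.
exists (a * j).+1; rewrite // -(ltn_pmul2r j0); apply: leq_trans (bernoulli _).
by rewrite mulnAC mulnC ltn_pmul2l ?expn_gt0 ?j0 //; lia.
Qed.

Section RandomFunctions.
Variables (r N : nat).

Local Notation choices := {ffun 'I_r * 'I_N -> 'I_N}.

Definition misses (A B : {set 'I_N}) (F : choices) : bool :=
  [forall p, (p.2 \in A) ==> (F p \notin B)].

Lemma card_misses (A B : {set 'I_N}) (m : nat) : #|A| = m -> #|B| = m ->
  #|[pred F | misses A B F]| = ((N - m) ^ m * N ^ (N - m)) ^ r.
Proof.
move=> cA cB; have cardC (X : {set 'I_N}) : #|~: X| = N - #|X|.
  by rewrite cardsCs setCK card_ord.
pose Q (p : 'I_r * 'I_N) := [pred y | (p.2 \in A) ==> (y \notin B)].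
have missesE F : misses A B F = (F \in family Q).
  by apply/forallP/familyP => FQ p; have := FQ p; rewrite inE.
rewrite (eq_card (B := (family Q : simpl_pred choices))); last exact: missesE.
rewrite card_family foldrE big_map big_enum /=.
have cQ p : #|Q p| = if p.2 \in A then N - m else N.
  rewrite /Q; case: (p.2 \in A).
    by rewrite -cB -cardC; apply: eq_card => y; rewrite !inE.
  by rewrite (eq_card (B := predT)) ?card_ord // => y; rewrite !inE.
rewrite (eq_bigr _ (fun p _ => cQ p)) -(pair_bigA _ (fun i x => if x \in A then N - m else N)) /=.
rewrite prod_nat_const card_ord; congr expn.
rewrite (bigID (mem A)) /= (eq_bigr (fun=> N - m)); last by move=> i ->.
rewrite [X in _ * X](eq_bigr (fun=> N)); last by move=> i /negPf->.
rewrite !prod_nat_const cA; congr (_ * _ ^ _).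
by rewrite -cA -cardC; apply: eq_card => x; rewrite !inE.
Qed.

(** Union bound over the at most [4 ^ N] pairs of sets; [card_misses] counts the functions that are
    bad for one pair. *)
Lemma exists_hitting (m : nat) :
  4 ^ N * ((N - m) ^ m * N ^ (N - m)) ^ r < (N ^ N) ^ r ->
  exists F : choices, forall A B : {set 'I_N}, #|A| = m -> #|B| = m -> ~~ misses A B F.
Proof.
move=> lt_bad.
have [/existsP[F /forallP good]|/existsPn bad] := boolP [exists F : choices,
    [forall p : {set 'I_N} * {set 'I_N}, (#|p.1| == m) ==> (#|p.2| == m) ==> ~~ misses p.1 p.2 F]].
  by exists F => A B cA cB; have := good (A, B); rewrite /= cA cB eqxx.
exfalso; move: lt_bad; apply/negP; rewrite -leqNgt.
have -> : (N ^ N) ^ r = #|choices|.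
  by rewrite card_ffun card_prod !card_ord mulnC expnM.
pose bad_pair (p : {set 'I_N} * {set 'I_N}) := (#|p.1| == m) && (#|p.2| == m).
have : #|choices| <= \sum_(F : choices) \sum_(p | bad_pair p) misses p.1 p.2 F.
  rewrite -sum1_card; apply: leq_sum => F _.
  have /forallPn[p] := bad F; rewrite !negb_imply => /and4P[c1 c2 mis _].
  by rewrite (bigD1 p) ?mis //= /bad_pair c1 c2.
move=> /leq_trans; apply; rewrite exchange_big /=.
apply: (@leq_trans (\sum_(p | bad_pair p) ((N - m) ^ m * N ^ (N - m)) ^ r)).
  apply: leq_sum => p /andP[/eqP c1 /eqP c2].
  rewrite -(card_misses c1 c2) -sum1_card big_mkcond /=.
  by rewrite [X in _ <= X]big_mkcond; apply: leq_sum => F _; rewrite inE; case: misses.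
rewrite sum_nat_const leq_mul2r; apply/orP; right.
apply: leq_trans (max_card _) _; rewrite card_prod.
have -> : #|{: {set 'I_N}}| = 2 ^ N.
  have := card_powerset [set: 'I_N]; rewrite cardsT card_ord => <-.
  by apply: eq_card => X; rewrite !inE subsetT.
by rewrite -expnMn.
Qed.
End RandomFunctions.

(** After cancelling [N ^ (N - m)] and the powers of [m], both sides are [m]-th powers of the sides
    of the hypothesis. Hence [r] can be chosen independently of [m], which keeps the degree of the
    expander bounded. *)
Lemma hitting_count (j r m : nat) : 0 < m -> 4 ^ j.+1 * j ^ r < j.+1 ^ r ->
  let N := j.+1 * m in
  4 ^ N * ((N - m) ^ m * N ^ (N - m)) ^ r < (N ^ N) ^ r.
Proof.
move=> m0 lt_r; cbv zeta; set N := j.+1 * m; have eN : N = m + j * m by rewrite /N mulSn.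
have -> : N - m = j * m by rewrite eN addKn.
have -> : (N ^ N) ^ r = (N ^ m) ^ r * (N ^ (j * m)) ^ r.
  by rewrite {2}eN expnD expnMn.
rewrite expnMn mulnA ltn_pmul2r; last by rewrite !expn_gt0 muln_gt0 m0.
have swap a : ((a * m) ^ m) ^ r = (a ^ r) ^ m * (m ^ r) ^ m.
  by rewrite !expnMn -!expnM (mulnC r).
rewrite /N !swap mulnA ltn_pmul2r; last by rewrite !expn_gt0 m0.
by rewrite expnM -expnMn ltn_exp2r.
Qed.

(* The graph consists of the pairs x, F (i, x) for a well-chosen function F of
   bounded out-degree r, after isolating the vertices of large in-degree. *)
Lemma expander (K : nat) : 0 < K -> exists Delta, forall m, 0 < m ->
  exists (e : rel 'I_(K * m)) (V0 : {set 'I_(K * m)}),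
  [/\ symmetric e, irreflexive e, K * m <= #|V0|.*2,
      forall x, #|[set y | e x y]| <= Delta &
      forall A B : {set 'I_(K * m)}, A \subset V0 -> B \subset V0 -> ~ hole e m A B].
Proof.
case: K => // j _; have [r r0 rlt] := exp_ratio_unbounded (4 ^ j.+1) j.
exists (3 * r) => m m0; set N := j.+1 * m.
have [|F hit] := @exists_hitting r N m.
  exact: hitting_count.
pose indeg x := #|[set p : 'I_r * 'I_N | F p == x]|.
(* The average in-degree is [r], so at most half of the vertices are excluded; on the others,
   out-degree and in-degree add up to at most [3 * r]. *)
pose V0 := [set x | indeg x <= 2 * r].
pose adj x y := [exists i, F (i, x) == y].
exists (fun x y => [&& x != y, x \in V0, y \in V0 & adj x y || adj y x]), V0; split.
- by move=> x y; rewrite eq_sym orbC; case: (x \in V0); case: (y \in V0).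
- by move=> x; rewrite eqxx.
- have: \sum_x indeg x = r * N.
    have -> : r * N = #|{: 'I_r * 'I_N}| by rewrite card_prod !card_ord.
    rewrite -sum1_card (partition_big F xpredT) //=; apply: eq_bigr => x _.
    by rewrite sum1_card /indeg; apply: eq_card => p; rewrite !inE.
  rewrite (bigID (mem V0)) /= => indeg_sum.
  have : #|~: V0| * (2 * r) <= r * N.
    rewrite -indeg_sum -sum_nat_const; apply: leq_trans (leq_addl _ _).
    rewrite (eq_bigl (fun x => x \notin V0)); last by move=> x; rewrite inE.
    by apply: leq_sum => x; rewrite inE -ltnNge; apply: ltnW.
  have -> : #|~: V0| * (2 * r) = r * #|~: V0|.*2 by rewrite -mul2n; lia.
  by rewrite leq_pmul2l //; have := cardsC V0; rewrite card_ord; card_lia.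
- move=> x; case: (boolP (x \in V0)) => xV0; last first.
    by rewrite (_ : [set _ | _] = set0) ?cards0 //; apply/setP=> y; rewrite !inE andbF.
  apply: (@leq_trans #|[set F (i, x) | i in 'I_r] :|:
      [set p.2 | p in [set p | F p == x]]|).
    apply: subset_leq_card; apply/subsetP=> y; rewrite !inE.
    move=> /and3P[_ _ /andP[_ /orP[/existsP[i /eqP Fy]|/existsP[i /eqP Fx]]]].
      by apply/orP; left; apply/imsetP; exists i.
    by apply/orP; right; apply/imsetP; exists (i, y); rewrite // inE Fx.
  have := (leq_card_setU [set F (i, x) | i in 'I_r] [set p.2 | p in [set p | F p == x]]).1.
  move=> /leq_trans; apply; rewrite mulSn; apply: leq_add.
    by rewrite (leq_trans (leq_imset_card _ _)) ?card_ord.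
  by rewrite (leq_trans (leq_imset_card _ _)) //; move: xV0; rewrite inE.
move=> A B AV BV [mA mB dAB nAB].
have [A' A'A cA'] := subset_of_card mA; have [B' B'B cB'] := subset_of_card mB.
have /forallPn[[i x]] := hit _ _ cA' cB'; rewrite negb_imply negbK /= => /andP[xA' yB'].
have xA := subsetP A'A _ xA'; have yB := subsetP B'B _ yB'.
have := nAB _ _ xA yB; rewrite (subsetP AV) ?(subsetP BV) //=.
have -> : adj x (F (i, x)) by apply/existsP; exists i.
rewrite andbT negbK => /eqP xy; move: dAB => /disjointFr /(_ xA).
by rewrite {1}xy yB.
Qed.

(** * Homogeneous blow-ups *)

Lemma ramsey_asym (T : finType) (c : rel T) (a b : nat) (X : {set T}) :
  symmetric c -> 2 ^ (a + b) <= #|X| ->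
  (exists Y : {set T}, [/\ Y \subset X, #|Y| = a & {in Y &, forall x y, x != y -> c x y}]) \/
  (exists Y : {set T}, [/\ Y \subset X, #|Y| = b & {in Y &, forall x y, x != y -> ~~ c x y}]).
Proof.
move=> csym; move sE: (a + b) => s; elim: s a b X sE => [|s IH] a b X sE Xs.
  left; exists set0; split; rewrite ?sub0set ?cards0; first by [].
    by move: sE; lia.
  by move=> x y; rewrite inE.
have [a0|a0] := posnP a.
  by left; exists set0; split; rewrite ?sub0set ?cards0 // => x y; rewrite inE.
have [b0|b0] := posnP b.
  by right; exists set0; split; rewrite ?sub0set ?cards0 // => x y; rewrite inE.
have /card_gt0P[x xX] : 0 < #|X| by apply: leq_trans Xs; rewrite expn_gt0.
pose N1 := [set y in X :\ x | c x y]; pose N2 := [set y in X :\ x | ~~ c x y].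
have N1X : N1 \subset X by apply/subsetP=> y; rewrite !inE => /andP[/andP[]].
have N2X : N2 \subset X by apply/subsetP=> y; rewrite !inE => /andP[/andP[]].
have add_point (P : rel T) (Z : {set T}) : symmetric P -> x \notin Z ->
    {in Z, forall y, P x y} -> {in Z &, forall y z, y != z -> P y z} ->
    {in x |: Z &, forall y z, y != z -> P y z}.
  move=> Psym xZ Px PZ y z /setU1P[->|yZ] /setU1P[->|zZ]; first by rewrite eqxx.
  - by move=> _; apply: Px.
  - by move=> _; rewrite Psym; apply: Px.
  - exact: PZ.
have [big1|big2] : 2 ^ s <= #|N1| \/ 2 ^ s <= #|N2|.
  have : #|X :\ x| = #|N1| + #|N2|.
    rewrite -(cardsID [set y | c x y] (X :\ x)); congr (_ + _).
      by apply: eq_card => y; rewrite !inE.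
    by apply: eq_card => y; rewrite !inE andbC.
  have := cardsD1 x X; rewrite xX; move: Xs; rewrite expnS.
  have : 0 < 2 ^ s by rewrite expn_gt0.
  by case: (leqP (2 ^ s) #|N1|) => [|?]; [left|right]; lia.
- have [||[Y [YN cY hY]]|[Y [YN cY hY]]] := IH a.-1 b N1; try by [lia|].
    have xY : x \notin Y by apply/negP => /(subsetP YN); rewrite !inE eqxx.
    left; exists (x |: Y); rewrite subUset sub1set xX (subset_trans YN N1X).
    split=> //; first by rewrite cardsU1 xY cY; lia.
    by apply: add_point => // y /(subsetP YN); rewrite inE => /andP[].
  by right; exists Y; split=> //; apply: subset_trans N1X.
have [||[Y [YN cY hY]]|[Y [YN cY hY]]] := IH a b.-1 N2; try by [lia|].
  by left; exists Y; split=> //; apply: subset_trans N2X.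
have xY : x \notin Y by apply/negP => /(subsetP YN); rewrite !inE eqxx.
right; exists (x |: Y); rewrite subUset sub1set xX (subset_trans YN N2X).
split=> //; first by rewrite cardsU1 xY cY; lia.
apply: (add_point (fun y z => ~~ c y z)) => // [y z|y /(subsetP YN)].
  by rewrite csym.
by rewrite inE => /andP[].
Qed.

Lemma ramsey (T : finType) (c : rel T) (s : nat) (X : {set T}) :
  symmetric c -> 4 ^ s <= #|X| ->
  exists (Y : {set T}) (b : bool),
    [/\ Y \subset X, #|Y| = s & {in Y &, forall x y, x != y -> c x y = b}].
Proof.
move=> csym Xs; have Xss : 2 ^ (s + s) <= #|X| by rewrite addnn -mul2n expnM.
have [[Y [YX cY hY]]|[Y [YX cY hY]]] := ramsey_asym csym Xss.
  by exists Y, true; split.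
by exists Y, false; split=> // x y xY yY /(hY x y xY yY)/negPf.
Qed.

(** Group the elements of [Y] by their traces on [s.*2] elements of [X]: there are [4 ^ s <= 4 ^ t]
    traces, so [t] elements share one, and this trace or its complement contains [s] of the [s.*2]
    elements. *)
Lemma bipartite_ramsey (T U : finType) (c : T -> U -> bool) (s t : nat)
    (X : {set T}) (Y : {set U}) :
  s <= t -> s.*2 <= #|X| -> 4 ^ t * t <= #|Y| ->
  exists (X' : {set T}) (Y' : {set U}) (b : bool),
    [/\ X' \subset X, #|X'| = s, Y' \subset Y, #|Y'| = t &
        {in X' & Y', forall x y, c x y = b}].
Proof.
move=> st /subset_of_card[X0 X0X cX0] Yt.
pose phi y := [set x in X0 | c x y].
have [A tA] : exists A : {set T}, t <= #|[set y in Y | phi y == A]|.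
  have [t0|t0] := posnP t; first by exists set0; rewrite t0.
  have [/existsP[A]|/existsPn small] := boolP [exists A : {set T}, t <= #|[set y in Y | phi y == A]|].
    by exists A.
  exfalso; have : #|Y| <= 4 ^ s * t.-1.
    rewrite -sum1_card (partition_big phi (fun A => A \in powerset X0)) /=; last first.
      by move=> y _; rewrite powersetE; apply/subsetP=> x; rewrite inE => /andP[].
    have -> : 4 ^ s = #|powerset X0| by rewrite card_powerset cX0 -mul2n expnM.
    rewrite -sum_nat_const; apply: leq_sum => A _; rewrite sum1_card.
    have := small A; rewrite -ltnNge => lt_t; rewrite -ltnS (prednK t0).
    apply: leq_ltn_trans lt_t.
    by apply: subset_leq_card; apply/subsetP=> y; rewrite !inE.
  have : 4 ^ s * t.-1 < 4 ^ t * t.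
    apply: (@leq_ltn_trans (4 ^ t * t.-1)); first by rewrite leq_mul2r leq_exp2l // st orbT.
    by rewrite ltn_mul2l expn_gt0 ltn_predL t0.
  by move: Yt; card_lia.
have [Y' Y'Y cY'] := subset_of_card tA.
have Y'sub : Y' \subset Y.
  by apply: subset_trans Y'Y _; apply/subsetP=> y; rewrite inE => /andP[].
have phiY y : y \in Y' -> phi y = A.
  by move=> /(subsetP Y'Y); rewrite inE => /andP[_ /eqP].
have [sA|sA] : s <= #|X0 :&: A| \/ s <= #|X0 :\: A|.
  have := cardsID A X0; rewrite cX0; case: (leqP s #|X0 :&: A|) => [|?]; [left|right] => //.
  by lia.
- have [X' X'X cX'] := subset_of_card sA; exists X', Y', true; split=> //.
    by apply: subset_trans X0X; apply: subset_trans X'X (subsetIl _ _).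
  move=> x y /(subsetP X'X); rewrite inE => /andP[_ xA] /phiY phiy.
  by move: xA; rewrite -phiy inE => /andP[].
have [X' X'X cX'] := subset_of_card sA; exists X', Y', false; split=> //.
  by apply: subset_trans X0X; apply: subset_trans X'X (subsetDl _ _).
move=> x y /(subsetP X'X); rewrite inE => /andP[xA xX0] /phiY phiy.
by move: xA; rewrite -phiy inE xX0 => /negPf.
Qed.

(** The size with which a bag must start so that [p] elements are left after [s] applications of
    [bipartite_ramsey]. *)
Fixpoint tower (p s : nat) : nat :=
  if s is s'.+1 then 4 ^ tower p s' * tower p s' else p.

Lemma tower_homo p : {homo tower p : a b / a <= b}.
Proof.
apply: homo_leq => //; first exact: leq_trans.
by move=> s; rewrite /= leq_pmull // expn_gt0.
Qed.

Section Homogeneous.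
Variables (V I : finType) (c : rel (V * I)).

(** The pairs are treated one by one, and a bag shrinks only when its vertex belongs to the pair. So
    the initial size depends on the number of pairs at a vertex and not on the length of [es], which
    grows with the graph. *)
Lemma homogeneous_pairs (p : nat) (es : seq (V * V)) (B : V -> {set I}) :
  (forall e, e \in es -> e.1 != e.2) ->
  (forall x, tower p (count (fun e => (e.1 == x) || (e.2 == x)) es) <= #|B x|) ->
  exists B' : V -> {set I}, [/\ forall x, B' x \subset B x, forall x, p <= #|B' x| &
    forall e, e \in es -> exists b : bool,
      {in B' e.1 & B' e.2, forall i j, c (e.1, i) (e.2, j) = b}].
Proof.
elim: es B => [|[x y] es IH] B es_ne Bbig.
  by exists B; split.
have xy : x != y by apply: (es_ne (x, y)); rewrite inE eqxx.
pose cnt z := count (fun e : V * V => (e.1 == z) || (e.2 == z)) es.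
have tower2 s : (tower p s).*2 <= tower p s.+1.
  by rewrite /= -mul2n; case: (tower p s) => // n; rewrite leq_mul2r /= expnS; have := expn_gt0 4 n; lia.
have Bx : tower p (cnt x).+1 <= #|B x| by have := Bbig x; rewrite /= eqxx.
have By : tower p (cnt y).+1 <= #|B y| by have := Bbig y; rewrite /= eqxx orbT.
have [X [Y [b [XB cX YB cY hXY]]]] : exists (X Y : {set I}) (b : bool),
    [/\ X \subset B x, #|X| = tower p (cnt x), Y \subset B y, #|Y| = tower p (cnt y) &
        {in X & Y, forall i j, c (x, i) (y, j) = b}].
  (* The side with the smaller target plays the role of the set that is merely halved. *)
  have [le|le] := leqP (cnt x) (cnt y).
    exact: bipartite_ramsey (tower_homo _ le) (leq_trans (tower2 _) Bx) By.
  have [Y [X [b [YB cY XB cX hXY]]]] := bipartite_ramsey (fun j i => c (x, i) (y, j))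
    (tower_homo p (ltnW le)) (leq_trans (tower2 _) By) Bx.
  by exists X, Y, b; split=> // i j iX jY; apply: hXY.
pose B1 z := if z == x then X else if z == y then Y else B z.
have B1B z : B1 z \subset B z.
  by rewrite /B1; case: eqP => [->//|_]; case: eqP => [->|].
have [||B' [B'B B'p B'h]] := IH B1.
- by move=> e ees; apply: es_ne; rewrite inE ees orbT.
- move=> z; rewrite /B1; case: (z =P x) => [->|_]; first by rewrite cX.
  case: (z =P y) => [->|_]; first by rewrite cY.
  by apply: leq_trans (Bbig z); apply: tower_homo; rewrite /= leq_addl.
exists B'; split=> //; first by move=> z; apply: subset_trans (B'B z) (B1B z).
move=> e; rewrite inE => /orP[/eqP->|]; last exact: B'h.
exists b => i j /(subsetP (B'B x)) iX /(subsetP (B'B y)) jY.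
apply: hXY; first by move: iX; rewrite /B1 eqxx.
by move: jY; rewrite /B1 eq_sym (negPf xy) eqxx.
Qed.

Lemma homogeneous_blowup (p D : nat) (near : rel V) (I0 : {set I}) :
  symmetric c -> symmetric near -> (forall x, #|[set y | near x y]| <= D) ->
  4 ^ tower p D.*2 <= #|I0| ->
  exists (B : V -> {set I}) (vcol : V -> bool) (ecol : V -> V -> bool),
  [/\ forall x, B x \subset I0, forall x, p <= #|B x|,
      forall x, {in B x &, forall i j, i != j -> c (x, i) (x, j) = vcol x} &
      forall x y, near x y -> x != y ->
        {in B x & B y, forall i j, c (x, i) (y, j) = ecol x y}].
Proof.
move=> csym nsym nD big0.
have /choice[B0 B0P] : forall x, exists B : {set I}, B \subset I0 /\ #|B| = tower p D.*2 /\
    exists b : bool, {in B &, forall i j, i != j -> c (x, i) (x, j) = b}.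
  move=> x; have [|Y [b [YI cY hY]]] := ramsey (c := fun i j => c (x, i) (x, j)) _ big0.
    by move=> i j; apply: csym.
  by exists Y; split=> //; split=> //; exists b.
have /choice[vcol vcolP] : forall x, exists b : bool,
    {in B0 x &, forall i j, i != j -> c (x, i) (x, j) = b}.
  by move=> x; have [_ [_]] := B0P x.
pose P := [pred e : V * V | near e.1 e.2 && (e.1 != e.2)].
have [||B [BB0 Bp Bh]] := @homogeneous_pairs p (enum P) B0.
- by move=> e; rewrite mem_enum => /andP[].
(* A vertex is the first entry of at most [D] ordered pairs and the second entry of at most [D],
   whence the height [D.*2]. *)
- move=> x; have [_ [-> _]] := B0P x; apply: tower_homo.
  rewrite -size_filter -(card_uniqP (filter_uniq _ (enum_uniq _))).
  apply: (@leq_trans #|[set (x, y) | y in [set y | near x y]] :|: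
      [set (y, x) | y in [set y | near x y]]|).
    apply: subset_leq_card; apply/subsetP=> -[y z].
    rewrite mem_filter mem_enum !inE /= => /andP[/orP[/eqP->|/eqP->] /andP[nyz _]].
      by apply/orP; left; apply: imset_f; rewrite inE.
    by apply/orP; right; apply: imset_f; rewrite inE nsym.
  apply: leq_trans (leq_card_setU _ _) _; rewrite -addnn.
  by apply: leq_add; apply: leq_trans (leq_imset_card _ _) (nD x).
have /choice[ecol ecolP] : forall e : V * V, exists b : bool, near e.1 e.2 -> e.1 != e.2 ->
    {in B e.1 & B e.2, forall i j, c (e.1, i) (e.2, j) = b}.
  move=> e; case: (boolP (e \in P)) => [eP|]; last first.
    by rewrite inE negb_and => /orP[/negPf->|/negPf->]; exists true.
  by have [|b hb] := Bh e; [rewrite mem_enum | exists b].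
exists B, vcol, (fun x y => ecol (x, y)); split=> //.
- by move=> x; apply: subset_trans (BB0 x) _; have [] := B0P x.
- by move=> x i j /(subsetP (BB0 x)) iB /(subsetP (BB0 x)) jB; apply: vcolP.
by move=> x y nxy xy i j iB jB; apply: (ecolP (x, y)).
Qed.
End Homogeneous.

(** * Balanced separators in chordal graphs *)

Section Chordal.
Variable Q : sgraph.
Local Notation e := (@edge Q).

(** The chord replaces the inner segment [s2], so the first and last vertices survive, and with them
    the closing edge of the cycle. *)
Lemma shortcut_ucycle (s1 s2 s3 : seq Q) (a b : Q) :
  let s := s1 ++ a :: s2 ++ b :: s3 in
  ucycle e s -> e a b -> next s a != b -> next s b != a ->
  ucycle e (s1 ++ a :: b :: s3) /\ 2 < size (s1 ++ a :: b :: s3) < size s.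
Proof.
move=> s /andP[cs us] eab nab nba.
have er : rot (size s1) s = a :: s2 ++ b :: s3 ++ s1.
  by rewrite /s rot_size_cat /= -catA.
have s2n : s2 != [::].
  apply: contra nab => /eqP s20; rewrite -(next_rot (size s1) us) er s20 /=.
  by rewrite eqxx.
have s13 : (s1 != [::]) || (s3 != [::]).
  apply: contraR nba; rewrite negb_or !negbK => /andP[/eqP s10 /eqP s30].
  have er2 : rot (size (a :: s2)) s = b :: a :: s2.
    by rewrite /s s10 s30 cat0s -cat_cons rot_size_cat.
  by rewrite -(next_rot (size (a :: s2)) us) er2 /= eqxx.
have cs' : cycle e (s1 ++ a :: b :: s3).
  rewrite -(rot_cycle (size s1)) rot_size_cat /= eab /=.
  move: cs; rewrite -(rot_cycle (size s1)) er /= -cats1 -catA cat_path /= -catA.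
  by rewrite -cats1 => /and3P[_ _]; rewrite catA.
split; last first.
  have s2_gt0 : 0 < size s2 by case: (s2) s2n.
  have s13_gt0 : 0 < size s1 + size s3 by case: (s1) s13; case: (s3).
  rewrite /s !size_cat /= !size_cat /=; move: s2_gt0 s13_gt0.
  by move: (size s1) (size s2) (size s3); clear; lia.
rewrite /ucycle cs' /=; apply: subseq_uniq us; rewrite /s.
apply: cat_subseq => //=; rewrite eqxx; exact: suffix_subseq.
Qed.

(** Shortening along chords keeps the closing edge and ends with a triangle on it. *)
Lemma chordal_triangle (s : seq Q) (x0 : Q) :
  chordal Q -> ucycle e s -> 2 < size s ->
  exists u, [/\ u \in s, e (head x0 s) u & e u (last x0 s)].
Proof.
move=> chQ; have [n] := ubnP (size s); elim: n s => // n IH s sn us s2.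
have [s3|s3] := leqP (size s) 3.
  have /eqP : size s == 3 by rewrite eqn_leq s3.
  case: s us {sn s2 s3} => [|a [|b [|c [|]]]] //= /andP[/= /and4P[eab ebc _ _] _] _.
  by exists b; rewrite !inE eqxx orbT.
have [x [y [xs ys exy nxy nyx]]] := chQ s us s3.
suff short a b s1 s2' s3' : s = s1 ++ a :: s2' ++ b :: s3' -> e a b ->
    next s a != b -> next s b != a ->
    exists u, [/\ u \in s, e (head x0 s) u & e u (last x0 s)].
  have mem_split z (t : seq Q) : z \in t -> exists t1 t2, t = t1 ++ z :: t2.
    by case/splitPr => t1 t2; exists t1, t2.
  have [s1 [s2' es]] := mem_split x s xs; move: (ys).
  rewrite {1}es mem_cat inE => /or3P[/mem_split[t1 [t2 es1]]|/eqP yx|/mem_split[t1 [t2 es2]]].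
  - apply: (short y x t1 t2 s2'); rewrite 1?edge_sym //.
    by rewrite es es1 -catA.
  - by move: exy; rewrite yx edge_irrefl.
  - by apply: (short x y s1 t1 t2) => //; rewrite es es2.
move=> es eab nab nba; rewrite es in us nab nba.
have [us' /andP[s'2 s'lt]] := shortcut_ucycle us eab nab nba.
have [|u [us1 eu1 eu2]] := IH _ _ us' s'2; first by rewrite -es in s'lt; apply: leq_trans s'lt _.
exists u; split.
- move: us1; rewrite es !mem_cat !inE !mem_cat !inE.
  by case/or4P => ->; rewrite ?orbT.
- by move: eu1; rewrite es; case: (s1).
- by move: eu2; rewrite es !last_cat /= last_cat.
Qed.

(* A vertex of the connected set C with as many neighbours in K as possible is
   adjacent to all of K. *)
Lemma chordal_complete_vertex (C K : {set Q}) (v0 : Q) :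
  chordal Q -> clique K -> [disjoint C & K] -> v0 \in C ->
  (forall x y, x \in C -> y \in C ->
     exists p, [/\ path e x p, {subset p <= C} & last x p = y]) ->
  (forall y, y \in K -> exists2 x, x \in C & e x y) ->
  exists2 v, v \in C & forall y, y \in K -> e v y.
Proof.
move=> chQ clK dCK v0C conn KN.
case: (arg_maxnP (fun v => #|[set y in K | e v y]|) v0C) => v vC vmax.
have [/existsP[y /andP[yK nvy]]|/existsPn all_adj] :=
    boolP [exists y, (y \in K) && ~~ e v y]; last first.
  by exists v => // y yK; have := all_adj y; rewrite yK negbK.
(* Follow a path in [C] from [v] to the first vertex [u] adjacent to [y]. For a neighbour [x] of [v]
   in [K], the cycle [x, v, ..., u, y] is closed by the clique edge between [y] and [x]. The
   triangle on this edge has its third vertex on the path and adjacent to [y], so this vertex is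
   [u]. Thus [u] is adjacent to [y] and to all neighbours of [v] in [K], against the choice of
   [v]. *)
exfalso.
have [u0 u0C eu0y] := KN y yK.
have [p0 [pp0 p0C lp0]] := conn v u0 vC u0C.
have [p [u [pp up pC luv [eu avoid]]]] : exists p u, [/\ path e v p, uniq (v :: p),
    {subset p <= C}, last v p = u & e u y /\ {in v :: p, forall z, e z y -> z = u}].
  have hasp : has (fun z => e z y) p0.
    case/lastP: p0 lp0 {pp0 p0C} => [/= vu|p0 z]; first by rewrite vu eu0y in nvy.
    by rewrite last_rcons => ->; rewrite has_rcons eu0y.
  case: (split_find hasp) pp0 p0C => u p1 p2 euy noy.
  rewrite cat_path => /andP[pp1 _] p0C.
  case: (shortenP pp1) (last_rcons v p1 u) => p' pp' up' p'1 lu.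
  exists p', u; split=> //; first by move=> z /p'1 zp; apply: p0C; rewrite mem_cat zp.
  split=> // z; rewrite inE => /orP[/eqP->|/p'1]; first by rewrite (negPf nvy).
  rewrite mem_rcons inE => /orP[/eqP//|zp1] ezy.
  by move: noy => /hasPn/(_ z zp1); rewrite ezy.
have uC : u \in C.
  have := mem_last v p; rewrite luv inE => /orP[/eqP->//|]; exact: pC.
suff sub : y |: [set x in K | e v x] \subset [set x in K | e u x].
  have /= := vmax u uC; rewrite leqNgt => /negP; apply; apply: leq_trans (subset_leq_card sub).
  by rewrite cardsU1 inE (negPf nvy) andbF.
rewrite subUset sub1set inE yK eu /=; apply/subsetP=> x; rewrite !inE => /andP[xK evx].
rewrite xK /=; have xy : x != y by apply: contraNneq nvy => <-.
have notK z : z \in v :: p -> z \notin K.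
  rewrite inE => /orP[/eqP->|/pC zC]; first by rewrite (disjointFr dCK vC).
  by rewrite (disjointFr dCK zC).
have us : ucycle e (x :: v :: rcons p y).
  rewrite /ucycle /= edge_sym evx /= rcons_path rcons_path pp luv eu last_rcons /=.
  rewrite edge_sym clK //= !inE !mem_rcons !inE !negb_or rcons_uniq.
  rewrite xy /=; move: up => /= /andP[vp ->]; rewrite vp andbT.
  have nvK := notK v (mem_head _ _).
  have -> : (x == v) = false by apply: contraNF nvK => /eqP <-.
  have -> : (v == y) = false by apply: contraNF nvK => /eqP ->.
  have -> : (x \in p) = false by apply: contraTF xK => xp; apply: notK; rewrite inE xp orbT.
  by rewrite andbT /=; apply: contraTN yK => yp; apply: notK; rewrite inE yp orbT.
have [|w [ws exw ewy]] := chordal_triangle x chQ us; first by rewrite /= size_rcons.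
move: exw ewy ws; rewrite /= last_rcons => exw ewy.
rewrite inE => /orP[/eqP wx|]; first by rewrite wx edge_irrefl in exw.
rewrite -rcons_cons mem_rcons inE => /orP[/eqP wy|wp]; first by rewrite wy edge_irrefl in ewy.
by rewrite edge_sym -(avoid w wp ewy).
Qed.
End Chordal.

Definition balanced_separator (G : sgraph) (S X A : {set G}) : Prop :=
  [/\ [disjoint X & A], forall x y, x \in A -> edge x y -> y \in X :|: A,
      3 * #|S :&: A| <= 2 * #|S| & 3 * #|S :\: (X :|: A)| <= 2 * #|S|].

Lemma connect_closed (T : finType) (r : rel T) (C : {pred T}) (x y : T) :
  (forall u v, u \in C -> r u v -> v \in C) -> x \in C -> connect r x y -> y \in C.
Proof.
move=> clC xC /connectP[p]; elim: p x xC => [|z p IH] x xC /=; first by move=> _ ->.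
by move=> /andP[rxz pp] ly; apply: (IH z) => //; apply: clC rxz.
Qed.

(** * Components outside a clique, and separators of chordal graphs *)

Section Separators.
Variable Q : sgraph.
Local Notation e := (@edge Q).
Implicit Types X A : {set Q}.

Definition avoiding (X : {set Q}) : rel Q := [rel a b | [&& e a b, a \notin X & b \notin X]].

Definition component (X : {set Q}) (a : Q) : {set Q} := [set b | connect (avoiding X) a b].

Lemma mem_component X a : a \in component X a.
Proof. by rewrite inE connect0. Qed.

Lemma component_avoids X a : a \notin X -> [disjoint component X a & X].
Proof.
move=> aX; rewrite -setI_eq0 -subset0; apply/subsetP=> b; rewrite !inE => /andP[cab bX].
suff : b \in [predC X] by rewrite inE /= bX.
by apply: connect_closed cab => [u v _|]; rewrite ?inE // => /and3P[].
Qed.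

Lemma component_closed X a x y :
  a \notin X -> x \in component X a -> e x y -> y \notin X -> y \in component X a.
Proof.
move=> aX xC exy yX; have xX := disjointFr (component_avoids aX) xC.
move: xC; rewrite !inE => /connect_trans; apply; apply: connect1.
by rewrite /avoiding /= exy xX yX.
Qed.

Lemma component_path X a x y : x \in component X a -> y \in component X a ->
  exists p, [/\ path e x p, {subset p <= component X a} & last x p = y].
Proof.
have csym : connect_sym (avoiding X).
  apply: sym_connect_sym => u v /=.
  by rewrite /avoiding /= edge_sym; case: (u \notin X); case: (v \notin X).
rewrite !inE => cax cay; have : connect (avoiding X) x y.
  by apply: connect_trans cay; rewrite csym.
case/connectP=> p pp ->; exists p; split=> //.
  by apply: sub_path pp => u v /= /and3P[].
move=> z zp; rewrite inE; apply: connect_trans cax _.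
by apply: (path_connect pp); rewrite inE zp orbT.
Qed.

(** While some component [C] outside the clique holds more than half of [S], replace the clique by
    its vertices with a neighbour in [C], plus a vertex [v] of [C] adjacent to all of these. A new
    component with more than half of [S] meets [C], cannot leave [C] without using a vertex of the
    new clique, and misses [v]; so the heavy component shrinks strictly. *)
Lemma balanced_clique (S : {set Q}) : chordal Q ->
  exists2 X : {set Q}, clique X &
    forall a, a \notin X -> 2 * #|S :&: component X a| <= #|S|.
Proof.
move=> chQ; pose good X := [forall a, (a \notin X) ==> (2 * #|S :&: component X a| <= #|S|)].
suff [X clX /forallP gX] : exists2 X : {set Q}, clique X & good X.
  by exists X => // a aX; have := gX a; rewrite aX.
suff descent n : forall X a, clique X -> a \notin X -> #|component X a| < n ->
    #|S| < 2 * #|S :&: component X a| -> exists2 X : {set Q}, clique X & good X.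
  have cl0 : clique (set0 : {set Q}) by move=> x y; rewrite inE.
  have [g0|/forallPn[a]] := boolP (good set0); first by exists set0.
  rewrite negb_imply -ltnNge => /andP[a0]; exact: descent cl0 a0 (ltnSn _).
elim: n => // n IH X a clX aX Cn Sbig; set C := component X a in Cn Sbig *.
pose K := [set y in X | [exists x in C, e x y]].
have KX : K \subset X by apply/subsetP=> y; rewrite inE => /andP[].
have clK : clique K by move=> x y /(subsetP KX) xX /(subsetP KX) yX; apply: clX.
have dCX := component_avoids aX.
have [v vC vK] : exists2 v, v \in C & forall y, y \in K -> e v y.
  apply: (chordal_complete_vertex chQ clK _ (mem_component X a)).
  - by apply: disjointWr dCX.
  - by move=> x y xC yC; apply: component_path.
  - by move=> y; rewrite inE => /andP[_ /exists_inP].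
have clX' : clique (v |: K).
  move=> x y /setU1P[->|xK] /setU1P[->|yK]; rewrite ?eqxx //.
  - by move=> _; apply: vK.
  - by move=> _; rewrite edge_sym; apply: vK.
  - exact: clK.
have [gX'|/forallPn[a']] := boolP (good (v |: K)); first by exists (v |: K).
rewrite negb_imply -ltnNge => /andP[aX' Dbig]; set D := component _ a' in Dbig.
have /card_gt0P[z] : 0 < #|(S :&: C) :&: (S :&: D)|.
  have := cardsUI (S :&: C) (S :&: D).
  have : #|(S :&: C) :|: (S :&: D)| <= #|S|.
    by apply: subset_leq_card; rewrite subUset !subsetIl.
  by move: Sbig Dbig; card_lia.
rewrite !in_setI => /andP[/andP[_ zC] /andP[_ zD]].
have DC : D \subset C.
  apply/subsetP=> w wD; have [p [pp pD <-]] := component_path zD wD.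
  have dD := component_avoids aX'.
  elim: p z {zD} zC pp pD => //= u p IHp z zC /andP[ezu pp] pD.
  apply: IHp => //; last by move=> t tp; apply: pD; rewrite inE tp orbT.
  apply: component_closed aX (zC) (ezu) _; apply/negP => uX.
  have : u \in v |: K by rewrite !inE uX; apply/orP; right; apply/exists_inP; exists z.
  by rewrite (disjointFr dD (pD u _)) // mem_head.
rewrite ltnS in Cn; apply: IH clX' (aX') _ Dbig; apply: leq_trans Cn; apply: proper_card.
rewrite properE DC; apply/subsetPn; exists v => //.
by apply/negP => vD; have := disjointFr (component_avoids aX') vD; rewrite setU11.
Qed.

(** Let [A] be closed with the largest trace on [S] not exceeding two thirds. If more than two
    thirds of [S] remain outside, [A] has less than one third, and adding a further component [C]
    overshoots two thirds. So [C] alone has more than one third of [S], and at most half by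
    [balanced_clique]. *)
Lemma chordal_balanced_separator (S : {set Q}) : chordal Q ->
  exists X A : {set Q}, clique X /\ balanced_separator S X A.
Proof.
move=> chQ; have [X clX balX] := balanced_clique S chQ; exists X.
pose closed A := [disjoint X & A] && [forall x in A, forall y, e x y ==> (y \in X :|: A)].
have closedP A : closed A -> [disjoint X & A] /\ forall x y, x \in A -> e x y -> y \in X :|: A.
  move=> /andP[dXA /forall_inP clA]; split=> // x y /clA/forallP/(_ y)/implyP; exact.
pose ok A := closed A && (3 * #|S :&: A| <= 2 * #|S|).
have ok0 : ok set0.
  rewrite /ok setI0 cards0 muln0 leq0n andbT /closed -setI_eq0 setI0 eqxx /=.
  by apply/forall_inP=> x; rewrite inE.
case: (arg_maxnP (fun A : {set Q} => #|S :&: A|) ok0) => A /andP[clA SA] maxA.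
have [dXA cA] := closedP A clA.
have [SB|SB] := leqP (3 * #|S :\: (X :|: A)|) (2 * #|S|); first by exists A.
have /card_gt0P[a] : 0 < #|S :\: (X :|: A)| by move: SB; card_lia.
rewrite !inE negb_or => /andP[/andP[aX aA] aS].
have Chalf := balX a aX; set C := component X a in Chalf.
have clC x y : x \in C -> e x y -> y \in X :|: C.
  by move=> xC exy; rewrite in_setU; case: (boolP (y \in X)) => //= yX; exact: component_closed xC exy yX.
have dXC : [disjoint X & C] by rewrite disjoint_sym; exact: component_avoids.
have SAC : 2 * #|S| < 3 * #|S :&: (A :|: C)|.
  rewrite ltnNge; apply/negP => SAC.
  have /maxA /= : ok (A :|: C).
    rewrite /ok SAC andbT /closed -setI_eq0 setIUr setU_eq0 !setI_eq0 dXA dXC /=.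
    apply/forall_inP => x; rewrite in_setU => xAC; apply/forallP => y; apply/implyP => exy.
    rewrite setUA in_setU; case/orP: xAC => [xA|xC]; first by rewrite (cA x y).
    by have := clC x y xC exy; rewrite !in_setU => /orP[->|->]; rewrite ?orbT.
  rewrite leqNgt => /negP; apply; apply: proper_card; rewrite properE setIS ?subsetUl //=.
  by apply/subsetPn; exists a; rewrite !inE ?aS ?(negPf aA) // connect0 orbT.
exists C; split=> //; split=> //; first by lia.
have := cardsID (X :|: A) S; have := cardsID (X :|: C) S.
have : #|S :&: C| <= #|S :&: (X :|: C)| by rewrite subset_leq_card // setIS // subsetUr.
have : #|S :&: A| <= #|S :&: (X :|: A)| by rewrite subset_leq_card // setIS // subsetUr.
have : #|S :&: (A :|: C)| <= #|S :&: A| + #|S :&: C|.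
  by rewrite setIUr; apply: (leq_card_setU _ _).1.
by move: SB SAC; card_lia.
Qed.
End Separators.

Lemma treewidth_balanced_separator (H : sgraph) (w : nat) : treewidth H < w ->
  forall S : {set H}, exists X A : {set H}, #|X| <= w /\ balanced_separator S X A.
Proof.
rewrite /treewidth; case: ex_minnP => k /asboolP[Q [chQ clQ [f [finj fe]]]] _ kw S.
have [X [A [clX [dXA cA SA SB]]]] := chordal_balanced_separator (f @: S) chQ.
have cX : #|X| <= w.
  (* Only cliques with exactly [k.+2] vertices are excluded in [Q]; a larger clique contains one of
     these. *)
  apply: leq_trans kw; rewrite -ltnS ltnNge; apply/negP => /subset_of_card[K KX cK].
  have /clQ : clique K by move=> x y /(subsetP KX) xX /(subsetP KX) yX; apply: clX.
  by rewrite cK eqxx.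
have card_pre (Y : {set Q}) : #|f @^-1: Y| <= #|Y|.
  rewrite -(card_imset _ finj); apply: subset_leq_card.
  by apply/subsetP=> y /imsetP[x]; rewrite inE => xY ->.
exists (f @^-1: X), (f @^-1: A); split; first exact: leq_trans (card_pre _) cX.
rewrite (card_imset _ finj) in SA SB; split.
- by rewrite -setI_eq0 -preimsetI (disjoint_setI0 dXA) preimset0.
- by move=> x y; rewrite -preimsetU !inE => xA exy; have := cA _ _ xA (fe _ _ exy); rewrite inE.
- apply: leq_trans SA; rewrite leq_mul2l /= -(card_imset (S :&: _) finj); apply: subset_leq_card.
  by apply/subsetP=> y /imsetP[x]; rewrite !inE => /andP[xS xA] ->; rewrite xA imset_f.
- apply: leq_trans SB; rewrite leq_mul2l /= -preimsetU -(card_imset (S :\: _) finj).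
  apply: subset_leq_card.
  apply/subsetP=> y /imsetP[x]; rewrite in_setD inE => /andP[xXA xS] ->.
  by rewrite in_setD xXA imset_f.
Qed.

(** * Tree partitions *)

(** The guards are there because [par] has an arbitrary value at the root [0]. *)
Definition linked (par : nat -> nat) (i j : nat) : bool :=
  [|| i == j, (0 < j) && (par j == i) | (0 < i) && (par i == j)].

(** Non-empty bags bound the number of nodes by the number of vertices, as the tree embeddings
    require. *)
Definition tree_partition (H : sgraph) (U : {set H}) (par : nat -> nat) (t : nat)
    (bag : H -> nat) : Prop :=
  [/\ 0 < t, forall i, 0 < i < t -> par i < i, forall x, x \in U -> bag x < t,
      forall i, i < t -> exists2 x, x \in U & bag x = i &
      {in U &, forall x y, edge x y -> linked par (bag x) (bag y)}].

Lemma subset_between (T : finType) (A B : {set T}) (k : nat) :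
  A \subset B -> #|A| <= k <= #|B| ->
  exists C : {set T}, [/\ A \subset C, C \subset B & #|C| = k].
Proof.
move=> AB /andP[Ak kB]; have [|C CB cC] := @subset_of_card _ (B :\: A) (k - #|A|).
  by rewrite cardsD (setIidPr AB) leq_sub2r.
exists (A :|: C); rewrite subsetUl subUset AB (subset_trans CB) ?subsetDl //.
split=> //; rewrite cardsU cC (_ : A :&: C = set0) ?cards0 ?subn0 ?subnKC //.
by apply/setP=> x; rewrite !inE; apply/negP => /andP[xA /(subsetP CB)]; rewrite inE xA.
Qed.

(** A new root is put above the tree and the old nodes move up by one. Node [1] is the old root,
    where [par] is meaningless; this explains the test [i <= 1]. *)
Definition graft_root (par : nat -> nat) (i : nat) : nat :=
  if i <= 1 then 0 else (par i.-1).+1.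

Lemma nchildren_graft_root par t i : 0 < t ->
  nchildren (graft_root par) t.+1 i = if i is i'.+1 then nchildren par t i' else 1.
Proof.
move=> t0; rewrite /nchildren big_ltn // big_add1 /=.
have -> : \sum_(1 <= j < t) (graft_root par j.+1 == i) = \sum_(1 <= j < t) ((par j).+1 == i).
  by apply: eq_big_nat => -[|j].
by case: i => [|i]; first by rewrite big1.
Qed.

Lemma linked_graft_root par i j : linked par i j -> linked (graft_root par) i.+1 j.+1.
Proof.
rewrite /linked /graft_root => /or3P[/eqP->|/andP[j0 /eqP<-]|/andP[i0 /eqP<-]].
- by rewrite eqxx.
- by case: j j0 => //= j _; rewrite eqxx orbT.
- by case: i i0 => //= i _; rewrite eqxx !orbT.
Qed.

(* Renumbering of the nodes of a second tree whose root is identified with the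
   root of a first tree on 0, ..., s-1. *)
Definition merged_index (s i : nat) : nat := if i == 0 then 0 else s + i.-1.

Definition merged_par (s : nat) (par1 par2 : nat -> nat) (i : nat) : nat :=
  if i < s then par1 i else merged_index s (par2 (i - s).+1).

Lemma nchildren_merge par1 par2 s t i : 0 < s -> 0 < t ->
  nchildren (merged_par s par1 par2) (s + t.-1) i =
  nchildren par1 s i + \sum_(1 <= j < t) (merged_index s (par2 j) == i).
Proof.
move=> s0 t0; rewrite /nchildren (@big_cat_nat _ _ _ s) ?leq_addr //=; congr (_ + _).
  by apply: eq_big_nat => j /andP[_ js]; rewrite /merged_par js.
transitivity (\sum_(0 + s <= j < t.-1 + s) (merged_par s par1 par2 j == i)).
  by rewrite add0n addnC.
rewrite big_addn addnK -[t in RHS](prednK t0) big_add1 /=.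
by apply: eq_big_nat => j _; rewrite /merged_par ltnNge leq_addl /= addnK.
Qed.

Lemma linked_merge par1 par2 s i j : 0 < s ->
  linked par2 i j -> linked (merged_par s par1 par2) (merged_index s i) (merged_index s j).
Proof.
move=> s0; have parE k : 0 < k ->
    0 < merged_index s k /\
    merged_par s par1 par2 (merged_index s k) = merged_index s (par2 k).
  move=> k0; rewrite /merged_par /merged_index (gtn_eqF k0) addn_gt0 s0.
  by rewrite (ltnNge (s + _)) leq_addr /= addKn prednK.
rewrite /linked => /or3P[/eqP->|/andP[/parE[-> ->] /eqP->]|/andP[/parE[-> ->] /eqP->]];
  by rewrite eqxx ?orbT.
Qed.

Section TreePartition.
Variables (H : sgraph) (w d : nat).
Hypotheses (w0 : 0 < w) (d0 : 0 < d) (degH : forall x : H, degree x <= d).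
Hypothesis sepH : forall S : {set H}, exists X A : {set H},
  #|X| <= w /\ balanced_separator S X A.

(* These bounds, due to Wood, pass through the induction: a small S becomes a new root
   above a partition rooted at its neighbourhood, and a large S is split along a
   balanced separator, the two partial partitions being merged at their roots. *)
Definition rooted_partition (U S : {set H}) par t bag :=
  [/\ tree_partition U par t bag, forall x, x \in S -> bag x = 0,
      2 * #|[set x in U | bag x == 0]| + 4 * w <= 3 * #|S|,
      2 * w * nchildren par t 0 + 2 * w <= #|S| &
      forall i, #|[set x in U | bag x == i]| <= 18 * w * d /\
                nchildren par t i < 6 * d].

Lemma rooted_partition_small (U S : {set H}) :
  S \subset U -> 4 * w <= #|S| <= 12 * w * d -> #|U :\: S| < 4 * w ->
  exists par t bag, rooted_partition U S par t bag.
Proof.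
move=> SU /andP[Sw Sd] USw.
have [x0 x0S] : exists x0, x0 \in S by apply/card_gt0P; move: Sw w0; card_lia.
have wd : w <= w * d by rewrite leq_pmulr.
pose bag x : nat := x \notin S.
pose t := (U :\: S != set0).+1.
have bag0 : [set x in U | bag x == 0] = S.
  apply/setP=> x; rewrite inE eqb0 negbK andbC; case: (boolP (x \in S)) => //= xS.
  exact: subsetP SU x xS.
have chE i : nchildren (fun=> 0) t i <= 1.
  rewrite /t; case: (U :\: S != set0); rewrite /nchildren; last by rewrite big_geq.
  by rewrite [X in X <= _]big_nat1; case: (0 == i).
exists (fun=> 0), t, bag; split.
- split=> //.
  + by move=> i /andP[].
  + move=> x xU; rewrite /bag /t; case: (boolP (x \in S)) => //= xS.
    by rewrite ltnS lt0b; apply/set0Pn; exists x; rewrite inE xS.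
  + move=> [|[|i]] it; last by move: it; rewrite /t; case: (U :\: S != set0).
      by exists x0; [exact: subsetP SU x0 x0S | rewrite /bag x0S].
    move: it; rewrite /t ltnS lt0b => /set0Pn[x]; rewrite inE => /andP[xS xU].
    by exists x; rewrite // /bag xS.
  + move=> x y _ _ _; rewrite /linked /bag.
    by case: (x \in S); case: (y \in S).
- by move=> x xS; rewrite /bag xS.
- by rewrite bag0; move: Sw; card_lia.
- by have := leq_mul (leqnn (2 * w)) (chE 0); move: Sw; card_lia.
move=> i; split; last by apply: leq_ltn_trans (chE i) _; move: d0; clear; lia.
case: i => [|i]; first by rewrite bag0; move: Sd wd; rewrite -!mulnA; card_lia.
apply: (@leq_trans #|U :\: S|); last by rewrite -!mulnA; move: USw wd; card_lia.
apply: subset_leq_card; apply/subsetP=> x; rewrite !inE /bag => /andP[->].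
by case: (x \in S).
Qed.

(** Neighbours of [S] outside [S] lie in [S'], hence in the old root bag, so edges leaving the new
    root bag [S] run only to its single child. *)
Lemma rooted_partition_graft (U S S' : {set H}) par t bag :
  S \subset U -> 4 * w <= #|S| <= 12 * w -> nbh (@edge H) (U :\: S) S \subset S' ->
  rooted_partition (U :\: S) S' par t bag -> #|S'| <= 12 * w * d ->
  exists par t bag, rooted_partition U S par t bag.
Proof.
move=> SU /andP[Sw Sd] NS' [[t0 par_lt bag_lt bag_onto bag_edge] bagS' _ ch0 sizes] S'd.
have wd : w <= w * d by rewrite leq_pmulr.
pose bag1 x := if x \in S then 0 else (bag x).+1.
have bag1_0 : [set x in U | bag1 x == 0] = S.
  apply/setP=> x; rewrite inE /bag1 andbC; case: (boolP (x \in S)) => //= xS.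
  exact: subsetP SU x xS.
have bag1S i : [set x in U | bag1 x == i.+1] = [set x in U :\: S | bag x == i].
  by apply/setP=> x; rewrite !inE /bag1; case: (x \in S); rewrite /= ?andbF.
exists (graft_root par), t.+1, bag1; split.
- split=> //.
  + move=> [|[|i]] //= it; rewrite /graft_root /= ltnS; exact: par_lt.
  + move=> x xU; rewrite /bag1; case: ifP => // xS; rewrite ltnS; apply: bag_lt.
    by rewrite inE xS.
  + case=> [_|i]; last first.
      rewrite ltnS => /bag_onto[x]; rewrite inE => /andP[xS xU] xi.
      by exists x; rewrite // /bag1 (negPf xS) xi.
    have /card_gt0P[x xS] : 0 < #|S| by move: Sw w0; card_lia.
    by exists x; [exact: subsetP SU x xS | rewrite /bag1 xS].
  + have cross x y : x \in S -> y \in U -> y \notin S -> edge x y -> bag y = 0.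
      move=> xS yU yS exy; apply: bagS'; apply: (subsetP NS'); apply/nbhP.
      by rewrite inE yS; split=> //; exists x.
    move=> x y xU yU exy; rewrite /bag1.
    case: (boolP (x \in S)) => xS; case: (boolP (y \in S)) => yS //.
    * by rewrite (cross x y).
    * by rewrite (cross y x) // edge_sym.
    * by apply: linked_graft_root; apply: bag_edge; rewrite ?inE ?xS ?yS.
- by move=> x xS; rewrite /bag1 xS.
- by rewrite bag1_0; move: Sw; card_lia.
- by rewrite nchildren_graft_root // muln1; move: Sw; card_lia.
case=> [|i]; first by rewrite bag1_0 nchildren_graft_root //; split; move: Sd wd d0; rewrite -?mulnA; card_lia.
by rewrite bag1S nchildren_graft_root.
Qed.

(** The additive terms [4 * w] and [2 * w] in [rooted_partition] pay for the merge: [#|S1| + #|S2|]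
    exceeds [#|S|] by at most [2 * w], the root bags share [X], and adding the inequalities of the
    two parts gives the same inequalities for [S]. With [#|S| <= 12 * w * d] they bound the root bag
    by [18 * w * d] and the number of its children strictly by [6 * d]; the other nodes keep their
    bags and children. *)
Lemma rooted_partition_merge (U U1 U2 S S1 S2 X : {set H}) par1 t1 bag1 par2 t2 bag2 :
  U = U1 :|: U2 -> U1 :&: U2 = X ->
  {in U1 & U2, forall x y, x \notin X -> y \notin X -> ~~ edge x y} ->
  S \subset S1 :|: S2 -> X \subset S1 -> X \subset S2 -> S1 \subset U1 -> S2 \subset U2 ->
  #|X| <= w -> #|S1| + #|S2| <= #|S| + 2 * #|X| -> #|S| <= 12 * w * d ->
  rooted_partition U1 S1 par1 t1 bag1 -> rooted_partition U2 S2 par2 t2 bag2 ->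
  exists par t bag, rooted_partition U S par t bag.
Proof.
move=> eU eX noedge SS XS1 XS2 SU1 SU2 Xw S12 Sd.
move=> [[t10 par1_lt bag1_lt bag1_onto bag1_edge] bagS1 size1 ch1 sizes1].
move=> [[t20 par2_lt bag2_lt bag2_onto bag2_edge] bagS2 size2 ch2 sizes2].
pose par := merged_par t1 par1 par2; pose t := t1 + t2.-1.
pose bag x := if x \in U1 then bag1 x else merged_index t1 (bag2 x).
have bagU1 x : x \in U1 -> bag x = bag1 x by rewrite /bag => ->.
have inX x : x \in U1 -> x \in U2 -> x \in X by move=> xU1 xU2; rewrite -eX inE xU1.
have bagU2 x : x \in U2 -> bag x = merged_index t1 (bag2 x).
  rewrite /bag => xU2; case: ifP => // /inX/(_ xU2) xX.
  by rewrite bagS1 ?bagS2 // ?(subsetP XS1) ?(subsetP XS2).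
have index_lt j : j < t2 -> merged_index t1 j < t.
  by rewrite /merged_index /t; case: eqP => [_|]; lia.
have indexE0 j : (merged_index t1 j == 0) = (j == 0).
  by rewrite /merged_index; case: (j =P 0); lia.
have index_inj i j : merged_index t1 i = merged_index t1 j -> i = j.
  by rewrite /merged_index; case: eqP => [->|]; case: eqP => [->|]; lia.
have index_onto i : t1 <= i -> merged_index t1 (i - t1).+1 = i by rewrite /merged_index /= => /subnKC.
have index_ge i : 0 < i -> t1 <= merged_index t1 i.
  by rewrite /merged_index lt0n => /negPf->; rewrite leq_addr.
have XU2 x : x \in X -> bag2 x = 0 by move=> xX; rewrite bagS2 ?(subsetP XS2).
pose B1 i := [set x in U1 | bag1 x == i]; pose B2 i := [set x in U2 | bag2 x == i].
have B0 : #|[set x in U | bag x == 0]| + #|X| <= #|B1 0| + #|B2 0|.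
  have XB2 : X \subset B2 0.
    by apply/subsetP=> x xX; rewrite inE XU2 // eqxx andbT; rewrite -eX inE in xX; case/andP: xX.
  have := cardsID X (B2 0); rewrite (setIidPr XB2) => <-; rewrite addnCA addnC leq_add2l.
  apply: leq_trans (leq_card_setU _ _); apply: subset_leq_card; apply/subsetP=> x.
  rewrite !inE eU inE => /andP[/orP[xU1|xU2]].
    by rewrite bagU1 // xU1 => ->.
  rewrite bagU2 // indexE0 xU2 => b2; case: (boolP (x \in U1)) => xU1 /=.
    by rewrite bagS1 //; apply: (subsetP XS1); apply: inX.
  by rewrite b2 andbT; apply: contra xU1; rewrite -eX inE => /andP[].
have size0 : 2 * #|[set x in U | bag x == 0]| + 4 * w <= 3 * #|S|.
  by move: size1 size2 B0 S12 Xw; rewrite -/(B1 0) -/(B2 0); card_lia.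
have chE i : nchildren par t i =
    nchildren par1 t1 i + \sum_(1 <= j < t2) (merged_index t1 (par2 j) == i).
  exact: nchildren_merge.
have ch0 : nchildren par t 0 = nchildren par1 t1 0 + nchildren par2 t2 0.
  by rewrite chE; congr addn; apply: eq_bigr => j _; rewrite indexE0.
have root0 : 2 * w * nchildren par t 0 + 2 * w <= #|S|.
  by rewrite ch0 mulnDr; move: ch1 ch2 S12 Xw; card_lia.
exists par, t, bag; split=> //.
- split.
  + by rewrite /t addn_gt0 t10.
  + move=> i /andP[i0 it]; rewrite /par /merged_par; case: (ltnP i t1) => it1.
      by apply: par1_lt; rewrite i0.
    have : par2 (i - t1).+1 < (i - t1).+1 by apply: par2_lt; move: it; rewrite /t; lia.
    rewrite /merged_index; case: eqP => [//|p0]; move: p0 it1; clear; lia.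
  + move=> x; rewrite eU inE => /orP[xU1|xU2]; last by rewrite bagU2 // index_lt // bag2_lt.
    by rewrite bagU1 // (leq_trans (bag1_lt x xU1)) // leq_addr.
  + move=> i it; case: (ltnP i t1) => it1.
      have [x xU1 bx] := bag1_onto i it1; exists x; first by rewrite eU inE xU1.
      by rewrite bagU1.
    have [|x xU2 bx] := bag2_onto (i - t1).+1; first by move: it; rewrite /t; lia.
    exists x; first by rewrite eU inE xU2 orbT.
    by rewrite bagU2 // bx index_onto.
  + move=> x y xU yU exy.
    suff [[xU1 yU1]|[xU2 yU2]] : (x \in U1 /\ y \in U1) \/ (x \in U2 /\ y \in U2).
    * rewrite !bagU1 //; move: (bag1_edge x y xU1 yU1 exy); rewrite /linked /par /merged_par.
      by rewrite (bag1_lt x xU1) (bag1_lt y yU1).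
    * by rewrite !bagU2 //; apply: linked_merge => //; apply: bag2_edge.
    move: xU yU; rewrite eU !inE.
    case: (boolP (x \in U1)) => xU1; case: (boolP (x \in U2)) => xU2 //= _;
      case: (boolP (y \in U1)) => yU1; case: (boolP (y \in U2)) => yU2 //= _;
      try by [left | right].
    * have := noedge _ _ xU1 yU2; rewrite exy -eX !inE (negPf xU2) (negPf yU1) andbF /=.
      by move=> /(_ isT isT).
    * have := noedge _ _ yU1 xU2; rewrite edge_sym exy -eX !inE (negPf xU1) (negPf yU2) andbF /=.
      by move=> /(_ isT isT).
- move=> x /(subsetP SS); rewrite inE => /orP[xS1|xS2].
    by rewrite bagU1 ?bagS1 // (subsetP SU1).
  by rewrite bagU2 ?bagS2 // (subsetP SU2).
move=> i; have [->|i0] := posnP i.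
  split; first by move: size0 Sd; rewrite -!mulnA; card_lia.
  rewrite -(@ltn_pmul2l (2 * w)) ?muln_gt0 //; move: root0 Sd w0.
  rewrite -!mulnA (mulnCA w 6 d); card_lia.
case: (ltnP i t1) => it1.
  split.
    apply: leq_trans (sizes1 i).1; apply: subset_leq_card; apply/subsetP=> x; rewrite !inE eU inE.
    move=> /andP[/orP[xU1|xU2]]; first by rewrite bagU1 // xU1.
    rewrite bagU2 // => /eqP ei; move: it1; rewrite -ei ltnNge index_ge // lt0n.
    by rewrite -indexE0 ei -lt0n.
  rewrite chE big1_seq ?addn0; first exact: (sizes1 i).2.
  move=> j _; case: (_ =P i) => // ei; move: it1; rewrite -ei ltnNge index_ge // lt0n.
  by rewrite -indexE0 ei -lt0n.
split.
  apply: leq_trans (sizes2 (i - t1).+1).1; apply: subset_leq_card; apply/subsetP=> x.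
  rewrite !inE eU inE => /andP[/orP[xU1|xU2]].
    by rewrite bagU1 // => /eqP ei; have := bag1_lt x xU1; rewrite ei ltnNge it1.
  rewrite bagU2 // xU2 => /eqP ei; apply/eqP; apply: index_inj.
  by rewrite ei index_onto.
have ch10 : nchildren par1 t1 i = 0.
  rewrite /nchildren big1_seq // => j /andP[_]; rewrite mem_index_iota => j1.
  by case: eqP => // ei; have := par1_lt j j1; rewrite ei; move: j1 it1; clear; lia.
rewrite chE ch10 add0n.
apply: leq_ltn_trans (sizes2 (i - t1).+1).2; apply: leq_sum => j _.
case: (_ =P i) => // ei; have -> : par2 j = (i - t1).+1; last by rewrite eqxx.
by apply: index_inj; rewrite ei index_onto.
Qed.

Lemma rooted_partition_exists (U S : {set H}) :
  S \subset U -> 4 * w <= #|S| <= 12 * w * d ->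
  exists par t bag, rooted_partition U S par t bag.
Proof.
have [n] := ubnP #|U|; elim: n U S => // n IH U S Un SU Sbounds.
have [Sw Sd] := andP Sbounds.
have wd : w <= w * d by rewrite leq_pmulr.
have [USw|USw] := ltnP #|U :\: S| (4 * w); first exact: rooted_partition_small.
(* The threshold is three times the lower bound [4 * w]. Above it, [S1] and [S2] below each have at
   least a third of [#|S|] elements, hence at least [4 * w]; up to it, [S] has at most [12 * w * d]
   neighbours. *)
have [S12|S12] := leqP #|S| (12 * w).
  pose N := nbh (@edge H) (U :\: S) S.
  have Nd : #|N| <= #|S| * d.
    apply: (@leq_trans #|\bigcup_(x in S) [set y | edge x y]|).
      apply: subset_leq_card; apply/subsetP=> y /nbhP[_ [x xS exy]].
      by apply/bigcupP; exists x; rewrite ?inE.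
    rewrite -sum_nat_const; elim/big_rec2: _ => [|x s B _ le]; first by rewrite cards0.
    by apply: leq_trans (leq_card_setU _ _) (leq_add (degH x) le).
  (* [N] may be too small for the induction hypothesis and is padded to [4 * w] elements, which
     [U :\: S] can supply. *)
  have [||S' [NS' S'U cS']] := @subset_between _ N (U :\: S) (maxn #|N| (4 * w)).
    exact: nbh_sub.
    by rewrite leq_maxl geq_max USw subset_leq_card ?nbh_sub.
  have S'd : #|S'| <= 12 * w * d.
    rewrite cS' geq_max; have := leq_mul S12 (leqnn d).
    by move: Nd wd; rewrite -!mulnA; card_lia.
  have [||par [t [bag part]]] := IH (U :\: S) S' _ S'U.
  - have := cardsD1; have := cardsID S U; rewrite (setIidPr SU).
    by move: Un Sw w0; card_lia.
  - by rewrite S'd cS' leq_maxr.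
  by apply: rooted_partition_graft part S'd; rewrite // Sw.
have [X [A [Xw [dXA cA SA SB]]]] := sepH S.
pose XU := X :&: U; pose U1 := U :&: (A :|: X); pose U2 := U :\: A.
pose S1 := S :&: A :|: XU; pose S2 := (S :\: (X :|: A)) :|: XU.
have XUw : #|XU| <= w by apply: leq_trans Xw; rewrite subset_leq_card ?subsetIl.
have AX x : x \in A -> x \notin X by move=> xA; rewrite (disjointFl dXA).
have eU : U = U1 :|: U2.
  by apply/setP=> x; rewrite !inE; case: (x \in U); case: (x \in A); case: (x \in X).
have eX : U1 :&: U2 = XU.
  apply/setP=> x; rewrite !inE; have /implyP := AX x.
  by case: (x \in U); case: (x \in A); case: (x \in X).
have cS1 : #|S1| <= #|S :&: A| + #|XU| by apply: (leq_card_setU _ _).1.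
have cS2 : #|S2| <= #|S :\: (X :|: A)| + #|XU| by apply: (leq_card_setU _ _).1.
have c12 : #|S :&: A| + #|S :\: (X :|: A)| <= #|S|.
  have := cardsID (X :|: A) S.
  have : #|S :&: A| <= #|S :&: (X :|: A)| by rewrite subset_leq_card // setIS // subsetUr.
  by card_lia.
have S_S1 : #|S| <= #|S1| + #|S :\: (X :|: A)|.
  apply: leq_trans (leq_card_setU _ _); apply: subset_leq_card; apply/subsetP=> x xS.
  rewrite !inE xS (subsetP SU x xS); case: (x \in X); case: (x \in A) => //.
have S_S2 : #|S| <= #|S2| + #|S :&: A|.
  apply: leq_trans (leq_card_setU _ _); apply: subset_leq_card; apply/subsetP=> x xS.
  rewrite !inE xS (subsetP SU x xS); case: (x \in X); case: (x \in A) => //.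
have S1U : S1 \subset U1.
  apply/subsetP=> x; rewrite !inE => /orP[/andP[/(subsetP SU)-> ->]//|/andP[-> ->]].
  by rewrite orbT.
have S2U : S2 \subset U2.
  apply/subsetP=> x; rewrite !inE => /orP[/andP[/norP[_ ->] /(subsetP SU)->]//|/andP[xX ->]].
  by rewrite andbT; apply: contraTN xX => /AX.
(* Each side loses a vertex of [S], since [S1] and [S2] have at most [2/3 * #|S| + w] elements,
   which is less than [#|S|]. *)
have proper (V T : {set H}) : V \subset U -> S :&: V \subset T -> #|T| < #|S| -> #|V| < #|U|.
  move=> VU SVT TS; apply: proper_card; rewrite properE VU /=; apply/negP => UV.
  move: TS; rewrite ltnNge => /negP; apply; apply: subset_leq_card.
  by apply: subset_trans SVT; rewrite subsetI subxx (subset_trans SU).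
have U1n : #|U1| < n.
  apply: leq_trans (_ : #|U| <= n); last by rewrite -ltnS.
  apply: (proper _ S1); first exact: subsetIl.
    apply/subsetP=> x; rewrite !inE => /and3P[-> ->]; case: (x \in A) => //= ->.
    by [].
  by move: cS1 SA S12 XUw; card_lia.
have U2n : #|U2| < n.
  apply: leq_trans (_ : #|U| <= n); last by rewrite -ltnS.
  apply: (proper _ S2); first exact: subsetDl.
    apply/subsetP=> x; rewrite !inE => /and3P[-> /negPf-> ->]; case: (x \in X) => //=.
  by move: cS2 SB S12 XUw; card_lia.
have [|par1 [t1 [bag1 part1]]] := IH U1 S1 U1n S1U.
  by move: cS1 S_S1 SA SB S12 XUw Sd; card_lia.
have [|par2 [t2 [bag2 part2]]] := IH U2 S2 U2n S2U.
  by move: cS2 S_S2 SA SB S12 XUw Sd; card_lia.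
apply: (rooted_partition_merge eU eX _ _ _ _ S1U S2U XUw _ Sd part1 part2).
- move=> x y; rewrite !inE => /andP[xU xAX] /andP[yA yU]; rewrite xU yU !andbT => xX yX.
  apply/negP => exy; move: xAX; rewrite (negPf xX) orbF => xA.
  by have := cA x y xA exy; rewrite inE (negPf yX) (negPf yA).
- apply/subsetP=> x xS; rewrite !inE xS (subsetP SU x xS).
  by case: (x \in X); case: (x \in A).
- exact: subsetUr.
- exact: subsetUr.
by move: cS1 cS2 c12; card_lia.
Qed.
End TreePartition.

(** * The Ramsey argument *)

Lemma bounded_tree_partition (H : sgraph) (k d : nat) :
  0 < #|H| -> 0 < d -> max_degree H <= d -> treewidth H <= k ->
  exists par t bag, [/\ t <= #|H|, tree_partition [set: H] par t bag,
    rooted_tree par t (6 * d) &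
    forall i, #|[set x | bag x == i]| <= 18 * k.+1 * d].
Proof.
move=> H0 d0 degH twH; pose w := k.+1.
have wd : w <= w * d by rewrite leq_pmulr.
suff [par [t [bag [part ch sizes]]]] : exists par t bag,
    [/\ tree_partition [set: H] par t bag, forall i, nchildren par t i <= 6 * d &
        forall i, #|[set x | bag x == i]| <= 18 * w * d].
  exists par, t, bag; have [_ par_lt _ onto _] := part; split=> //.
  have /choice[g gP] : forall i : 'I_t, exists x, bag x = i.
    by move=> i; have [x _] := onto i (ltn_ord i); exists x.
  rewrite -[t]card_ord; apply: (leq_card g) => i j gij; apply: val_inj.
  by rewrite /= -gP gij gP.
have degH' (x : H) : degree x <= d.
  by apply: leq_trans degH; rewrite /max_degree (bigD1 x) //= leq_maxl.
have [Hw|Hw] := ltnP #|H| (4 * w); last first.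
  have [|S _ cS] := @subset_of_card _ [set: H] (4 * w); first by rewrite cardsT.
  have [||par [t [bag [part _ _ _ sizes]]]] := @rooted_partition_exists H w d isT d0 degH'
      (@treewidth_balanced_separator H w twH) [set: H] S; first exact: subsetT.
    by rewrite cS leqnn /=; move: wd; rewrite -!mulnA; clear; lia.
  exists par, t, bag; split=> // i; first by apply: ltnW; have [] := sizes i.
  have [+ _] := sizes i; congr (_ <= _); apply: eq_card => x.
  by rewrite !inE.
exists (fun=> 0), 1, (fun=> 0); split.
- split=> //; first by move=> [|i].
  by move=> [|i] // _; have /card_gt0P[x _] := H0; exists x.
- by move=> i; rewrite /nchildren big_geq.
move=> i; apply: leq_trans (max_card _) _; move: Hw wd; rewrite -!mulnA.
by card_lia.
Qed.

Lemma bag_rank (T : finType) (bag : T -> nat) (p : nat) :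
  (forall i, #|[set x | bag x == i]| <= p) ->
  exists rk : T -> nat, (forall x, rk x < p) /\
    forall x y, bag x = bag y -> rk x = rk y -> x = y.
Proof.
move=> bag_le; exists (fun x => index x (enum [set y | bag y == bag x])); split.
  move=> x; apply: leq_trans (bag_le (bag x)).
  by rewrite cardE index_mem mem_enum inE.
move=> x y bxy; rewrite bxy => ixy.
have mem z : bag z = bag y -> z \in enum [set y0 | bag y0 == bag y].
  by move=> bz; rewrite mem_enum inE bz.
by rewrite -(nth_index x (mem x bxy)) ixy nth_index // mem.
Qed.

(** The parity of the depth, which will give adjacent bags disjoint ranges of star leaves. *)
Lemma tree_levels (par : nat -> nat) (t : nat) :
  (forall i, 0 < i < t -> par i < i) ->
  exists lev : nat -> bool, forall i, 0 < i < t -> lev i = ~~ lev (par i).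
Proof.
elim: t => [|t IH] par_lt; first by exists xpredT => i; rewrite ltn0 andbF.
have [|lev levP] := IH; first by move=> i /andP[i0 it]; apply: par_lt; rewrite i0 ltnW.
exists (fun i => if i == t then ~~ lev (par t) else lev i) => i /andP[i0 it].
have := par_lt i; rewrite i0 it => /(_ isT) pi.
move: it; rewrite ltnS leq_eqVlt; case: eqP => [it _|_ /= it].
  by rewrite it in pi *; rewrite (ltn_eqF pi).
by rewrite (ltn_eqF (ltn_trans pi it)) levP // i0.
Qed.

Lemma no_hole_edge (V : finType) (r : rel V) (m : nat) (A B : {set V}) :
  ~ hole r m A B -> m <= #|A| -> m <= #|B| -> [disjoint A & B] ->
  exists x y, [/\ x \in A, y \in B & r x y].
Proof.
move=> nh mA mB dAB; apply: contrapT => none; apply: nh; split=> // x y xA yB.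
by apply/negP => rxy; apply: none; exists x, y.
Qed.

(** * Families of sets without edges between them, and stars across them *)

Section Embedding.
Variables (V : finType) (D n : nat).
Local Notation L := (D.*2 + 6).

(** One side of each hole supplies a member of the family and the search continues inside the other
    side, at the cost of a factor [L] in size. *)
Lemma hole_family (r : rel V) par t (s j : nat) (W : {set V}) :
  symmetric r -> 0 < t -> t <= n -> rooted_tree par t D -> n.*2 <= s -> L ^ j * s <= #|W| ->
  (exists f, tree_copy r W par t f) \/
  (exists Vs : nat -> {set V}, [/\ forall i, i <= j -> Vs i \subset W,
     forall i, i <= j -> #|Vs i| = s &
     forall i i' x y, i <= j -> i' <= j -> i != i' -> x \in Vs i -> y \in Vs i' ->
       x != y /\ ~~ r x y]).
Proof.
move=> rsym t0 tn treeT ns; elim: j W => [|j IH] W.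
  rewrite mul1n => /subset_of_card[W' W'W cW']; right; exists (fun=> W').
  by split=> // [[]] // [].
rewrite expnS -mulnA => Wbig.
have s_le : s <= L ^ j * s by rewrite leq_pmull // expn_gt0 addn_gt0 orbT.
have [|[A [B [AW BW [cA cB dAB hAB]]]]] :=
  hole_or_tree_copy r t0 tn (leq_trans ns s_le) treeT Wbig; first by left.
have [[f [fA finj fe]]|[Vs [VsA cVs hVs]]] := IH A cA.
  by left; exists f; split=> // i /fA; apply: subsetP.
right; have [B' B'B cB'] := subset_of_card (leq_trans s_le cB).
exists (fun i => if i == j.+1 then B' else Vs i); split.
- move=> i; rewrite leq_eqVlt; case: eqP => [_ _|_ /= ij]; first exact: subset_trans BW.
  exact: subset_trans (VsA i ij) AW.
- by move=> i; rewrite leq_eqVlt; case: eqP => //= _ /cVs.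
have cross i x y : i <= j -> x \in Vs i -> y \in B' -> x != y /\ ~~ r x y.
  move=> ij /(subsetP (VsA i ij)) xA /(subsetP B'B) yB; split; last exact: hAB.
  by apply: contraFneq (disjointFr dAB xA) => ->.
have last_or i : i <= j.+1 -> i = j.+1 \/ i <= j /\ (i == j.+1) = false.
  by rewrite leq_eqVlt; case: eqP => [->|_ /=]; [left | right].
move=> i i' x y /last_or[->|[ij ->]] /last_or[->|[ij' ->]]; rewrite ?eqxx //.
- by move=> _ xB yV; have [] := cross i' y x ij' yV xB; rewrite eq_sym rsym.
- by move=> _ xV yB; apply: (cross i).
exact: hVs.
Qed.

Section Expander.
Variables (e : rel V) (V0 : {set V}) (m : nat).

Hypothesis no_hole : forall A B : {set V}, A \subset V0 -> B \subset V0 -> ~ hole e m A B.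

(** Greedy choice: while more than [m] vertices of [A] are unmatched, so are more than [m] of [B],
    and an edge joins these leftovers because they form no hole. *)
Lemma almost_perfect_matching (A B : {set V}) :
  A \subset V0 -> B \subset V0 -> [disjoint A & B] -> #|A| <= #|B| ->
  exists (A' : {set V}) (g : V -> V), [/\ A' \subset A, #|A| <= #|A'| + m,
    forall x, x \in A' -> g x \in B /\ e x (g x) & {in A' &, injective g}].
Proof.
have [s] := ubnP #|A|; elim: s A B => // s IH A B As AV BV dAB AB.
have [Am|mA] := leqP #|A| m.
  by exists set0, id; split; rewrite ?sub0set ?cards0 // => x; rewrite ?inE.
have [x [y [xA yB exy]]] := no_hole_edge (no_hole AV BV) (ltnW mA) (ltnW (leq_trans mA AB)) dAB.
have cA := cardsD1 x A; have cB := cardsD1 y B; rewrite xA in cA; rewrite yB in cB.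
have [|||||A' [g [A'A cA' gB ginj]]] := IH (A :\ x) (B :\ y).
- by move: As; rewrite cA; card_lia.
- exact: subset_trans (subsetDl _ _) AV.
- exact: subset_trans (subsetDl _ _) BV.
- by apply: disjointWl (subsetDl _ _) _; apply: disjointWr (subsetDl _ _) dAB.
- by move: AB; rewrite cA cB; card_lia.
have xA' : x \notin A' by apply/negP => /(subsetP A'A); rewrite !inE eqxx.
have neqx z : z \in A' -> (z == x) = false by move=> zA'; apply: contraNF xA' => /eqP <-.
exists (x |: A'), (fun z => if z == x then y else g z); split.
- by rewrite subUset sub1set xA (subset_trans A'A) ?subsetDl.
- by rewrite cardsU1 xA' cA; move: cA'; card_lia.
- move=> z /setU1P[->|zA']; first by rewrite eqxx.
  by rewrite neqx //; have [] := gB z zA'; rewrite inE => /andP[_ ->].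
have gy z : z \in A' -> g z <> y.
  by move=> zA' gzy; have [] := gB z zA'; rewrite gzy !inE eqxx.
move=> z z' /setU1P[->|zA'] /setU1P[->|zA''] //; rewrite ?eqxx ?neqx //.
- by move=> yg; case: (gy z').
- by move=> /gy; case.
- exact: ginj.
Qed.

(** Each of the [q] matchings from [Vs 0] misses at most [m] vertices; the centres are the vertices
    covered by all of them. *)
Lemma star_family (Vs : nat -> {set V}) (q s : nat) :
  (forall i, i <= q -> Vs i \subset V0) -> (forall i, i <= q -> #|Vs i| = s) ->
  (forall i, 0 < i <= q -> [disjoint Vs 0 & Vs i]) ->
  exists (U : {set V}) (g : V -> nat -> V), [/\ U \subset Vs 0, s <= #|U| + q * m &
    forall i, i < q -> {in U &, injective (g^~ i)} /\
      forall x, x \in U -> g x i \in Vs i.+1 /\ e x (g x i)].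
Proof.
elim: q => [|q IH] VsV cVs dVs.
  by exists (Vs 0), (fun x _ => x); split=> //; rewrite cVs ?addn0.
have [|||U [g [UV cU gP]]] := IH.
- by move=> i iq; apply: VsV; apply: leqW.
- by move=> i iq; apply: cVs; apply: leqW.
- by move=> i /andP[i0 iq]; apply: dVs; rewrite i0 leqW.
have [||||A' [h [A'V cA' hP hinj]]] := @almost_perfect_matching (Vs 0) (Vs q.+1).
- exact: VsV.
- exact: VsV.
- by rewrite dVs ?leqnn.
- by rewrite !cVs.
exists (U :&: A'), (fun x i => if i == q then h x else g x i); split.
- by apply: subset_trans UV; apply: subsetIl.
- rewrite mulSn; have := cardsUI U A'; rewrite cVs // in cA'.
  have : #|U :|: A'| <= s by rewrite -(cVs 0) // subset_leq_card // subUset UV.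
  by move: cU cA'; card_lia.
move=> i; rewrite ltnS leq_eqVlt; case: eqP => [-> _|_ /= iq].
  split; last by move=> x; rewrite inE => /andP[_ /hP].
  by move=> x y; rewrite !inE => /andP[_ xA] /andP[_ yA]; apply: hinj.
have [ginj gV] := gP i iq; split; last by move=> x; rewrite inE => /andP[/gV].
by move=> x y; rewrite !inE => /andP[xU _] /andP[yU _]; apply: ginj.
Qed.
End Expander.
End Embedding.

Section Near.
Variables (V : finType) (e : rel V).

(** Distance at most three, so that leaves of two stars with equal or adjacent centres are always
    near. *)
Definition near (x y : V) : bool :=
  [exists a, exists b, [&& (x == a) || e x a, (a == b) || e a b & (b == y) || e b y]].

Lemma nearI x y a b : (x == a) || e x a -> (a == b) || e a b -> (b == y) || e b y -> near x y.
Proof. by move=> xa ab by_; apply/existsP; exists a; apply/existsP; exists b; apply/and3P. Qed.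

Lemma near_sym : symmetric e -> symmetric near.
Proof.
move=> esym; apply: symmetric_from_pre => x y /existsP[a /existsP[b /and3P[xa ab yb]]].
by apply: (@nearI _ _ b a); rewrite eq_sym esym.
Qed.

Lemma card_near (Delta : nat) (x : V) : (forall x, #|[set y | e x y]| <= Delta) ->
  #|[set y | near x y]| <= Delta.+1 ^ 3.
Proof.
move=> eD; pose ball (X : {set V}) := \bigcup_(x in X) [set y | (x == y) || e x y].
have card_ball X : #|ball X| <= #|X| * Delta.+1.
  rewrite -sum_nat_const /ball; elim/big_rec2: _ => [|y s B _ le]; first by rewrite cards0.
  apply: leq_trans (leq_card_setU _ _) (leq_add _ le).
  apply: leq_trans (_ : #|y |: [set z | e y z]| <= _).
    by apply: subset_leq_card; apply/subsetP=> z; rewrite !inE eq_sym.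
  by rewrite cardsU1; have := eD y; case: (_ \notin _); card_lia.
have -> : [set y | near x y] = ball (ball (ball [set x])).
  apply/setP=> y; rewrite inE; apply/existsP/bigcupP.
    case=> a /existsP[b /and3P[xa ab yb]]; exists b; last by rewrite inE.
    apply/bigcupP; exists a; last by rewrite inE.
    by apply/bigcupP; exists x; rewrite ?inE.
  case=> b /bigcupP[a /bigcupP[x' ]]; rewrite !inE => /eqP-> xa ab yb.
  by exists a; apply/existsP; exists b; apply/and3P.
rewrite 2!expnSr expn1; apply: leq_trans (card_ball _) _; rewrite leq_mul2r /=.
apply: leq_trans (card_ball _) _; rewrite leq_mul2r /=.
by apply: leq_trans (card_ball _) _; rewrite cards1 mul1n.
Qed.
End Near.

Section Dichotomy.
Variables (V : finType) (e r : rel V) (V0 W : {set V}) (D n q m : nat).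
Local Notation L := (D.*2 + 6).
Hypotheses (esym : symmetric e) (rsym : symmetric r) (nm : n.*2 <= m).
Hypothesis no_hole : forall A B : {set V}, A \subset V0 -> B \subset V0 -> ~ hole e m A B.
Hypothesis WV0 : W \subset V0.
Hypothesis Wbig : L ^ q * ((L + q) * m) <= #|W|.

(* Iterating [hole_or_tree_copy] on W gives q + 1 sets without r-edges between them.
   Matchings from one of them to the q others form stars; a copy of the first tree
   is then embedded by e into the centres of the stars. *)
Lemma tree_copy_or_blowup par1 t1 par2 t2 :
  0 < t1 -> t1 <= n -> rooted_tree par1 t1 D ->
  0 < t2 -> t2 <= n -> rooted_tree par2 t2 D ->
  (exists f, tree_copy r W par2 t2 f) \/
  exists g : nat -> nat -> V,
    [/\ forall i s, i < t1 -> s < q -> g i s \in W,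
        forall i j s s', i < t1 -> j < t1 -> s < q -> s' < q -> g i s = g j s' -> i = j /\ s = s' &
        forall i j s s', i < t1 -> j < t1 -> s < q -> s' < q -> s != s' -> linked par1 i j ->
          [/\ near e (g i s) (g j s'), g i s != g j s' & ~~ r (g i s) (g j s')]].
Proof.
move=> t10 t1n tree1 t20 t2n tree2.
have ns : n.*2 <= (L + q) * m.
  by apply: leq_trans nm _; rewrite leq_pmull // !addn_gt0 orbT.
have [|[Vs [VsW cVs hVs]]] := hole_family rsym t20 t2n tree2 ns Wbig; first by left.
right.
have [|||U [g [UV cU gP]]] := @star_family _ e V0 m no_hole Vs q ((L + q) * m).
- by move=> i iq; apply: subset_trans (VsW i iq) WV0.
- exact: cVs.
- move=> i /andP[i0 iq]; rewrite -setI_eq0 -subset0; apply/subsetP=> x.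
  rewrite inE => /andP[x0 xi]; have [] := hVs 0 i x x (leq0n _) iq _ x0 xi.
    by rewrite eq_sym -lt0n.
  by rewrite eqxx.
have UV0 : U \subset V0 by apply: subset_trans UV (subset_trans (VsW 0 (leq0n _)) WV0).
(* The sets were given size [(L + q) * m] so that [L * m] centres survive the loss of [q * m]. *)
have [|[f [fU finj fe]]|[A [B [AU BU hAB]]]] :=
  @hole_or_tree_copy _ e U par1 t1 D m n t10 t1n nm tree1.
- by move: cU; rewrite mulnDl; card_lia.
- exists (fun i => g (f i)); split.
  + move=> i s it sq; have [_ /(_ _ (fU i it))[gV _]] := gP s sq.
    exact: subsetP (VsW _ sq) _ gV.
  + move=> i j s s' it jt sq sq' eg; have [ginj /(_ _ (fU i it))[gi _]] := gP s sq.
    have [_ /(_ _ (fU j jt))[gj _]] := gP s' sq'.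
    have ss : s = s'.
      apply/eqP; apply: contraT => ne; have [] := hVs s.+1 s'.+1 _ _ sq sq' ne gi gj.
      by rewrite eg eqxx.
    by split=> //; apply: finj => //; apply: ginj; rewrite ?fU //; move: eg; rewrite -ss.
  move=> i j s s' it jt sq sq' ne lij.
  have [_ /(_ _ (fU i it))[gi ei]] := gP s sq.
  have [_ /(_ _ (fU j jt))[gj ej]] := gP s' sq'.
  have [gne nr] := hVs s.+1 s'.+1 _ _ sq sq' ne gi gj.
  split=> //; apply: (@nearI _ _ _ _ (f i) (f j)).
  - by rewrite esym ei orbT.
  - case/or3P: lij => [/eqP->|/andP[j0 /eqP<-]|/andP[i0 /eqP<-]]; first by rewrite eqxx.
      by rewrite fe ?orbT // j0.
    by rewrite esym fe ?orbT // i0.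
  - by rewrite ej orbT.
by case: (no_hole (subset_trans AU UV0) (subset_trans BU UV0) hAB).
Qed.
End Dichotomy.

(** * The host graph and its colourings *)

Section Host.
Variables (V I : finType) (e : rel V) (I0 : {set I}).

(** Elements of [I] outside [I0] only give isolated vertices, which pad the vertex count to [c * n]
    for the same [c] that bounds the degree. Both orders of [near] appear so that the relation is
    symmetric for every [e]. *)
Definition host_edge (a b : V * I) : bool :=
  [&& a != b, near e a.1 b.1 || near e b.1 a.1, a.2 \in I0 & b.2 \in I0].

Lemma host_edge_sym : symmetric host_edge.
Proof.
by move=> a b; rewrite /host_edge eq_sym orbC; case: (a.2 \in I0); case: (b.2 \in I0).
Qed.

Lemma host_edge_irrefl : irreflexive host_edge.
Proof. by move=> a; rewrite /host_edge eqxx. Qed.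

Definition host : sgraph := SGraph host_edge_sym host_edge_irrefl.

Lemma card_host : #|host| = #|V| * #|I|.
Proof. exact: card_prod. Qed.

Lemma max_degree_host (Delta : nat) : symmetric e ->
  (forall x, #|[set y | e x y]| <= Delta) -> max_degree host <= Delta.+1 ^ 3 * #|I0|.
Proof.
move=> esym eD; apply/bigmax_leqP => -[x i] _; rewrite /degree.
apply: leq_trans (_ : #|setX [set y | near e x y] I0| <= _).
  apply: subset_leq_card; apply/subsetP=> -[y j]; rewrite !inE /= /host_edge /=.
  by move=> /and4P[_ + _ ->]; rewrite (near_sym esym y) orbb andbT.
by rewrite cardsX leq_mul2r card_near ?orbT.
Qed.
End Host.

Lemma near_refl (V : finType) (e : rel V) (x : V) : near e x x.
Proof. by apply: (@nearI _ _ _ _ x x); rewrite eqxx. Qed.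

Definition colour_of (b : bool) : colour := if b then Red else Blue.
Definition is_red (a : colour) : bool := if a is Red then true else false.

Lemma is_redK : cancel is_red colour_of. Proof. by case. Qed.

Lemma nat_indexing (T : finType) (A : {set T}) (p : nat) : 0 < p -> p <= #|A| ->
  exists g : nat -> T, (forall i, i < p -> g i \in A) /\
    forall i j, i < p -> j < p -> g i = g j -> i = j.
Proof.
move=> p0 pA; have /card_gt0P[x xA] := leq_trans p0 pA.
have lt_enum i : i < p -> i < size (enum A) by move=> ip; rewrite -cardE (leq_trans ip).
exists (nth x (enum A)); split.
  by move=> i /lt_enum it; rewrite -mem_enum mem_nth.
by move=> i j /lt_enum it /lt_enum jt /eqP; rewrite nth_uniq ?enum_uniq // => /eqP.
Qed.

Section Arrowing.
Variables (V I : finType) (e : rel V) (V0 : {set V}) (I0 : {set I}).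
Variables (p D n m : nat).
Local Notation L := (D.*2 + 6).
Hypotheses (esym : symmetric e) (p0 : 0 < p) (nm : n.*2 <= m).
Hypothesis no_hole : forall A B : {set V}, A \subset V0 -> B \subset V0 -> ~ hole e m A B.
Local Notation G := (host e I0).
Variable chi : colouring G.
Let c (a b : V * I) : bool := is_red (chi ([set (a : G); (b : G)])).

Variables (B : V -> {set I}) (vcol : V -> bool) (ecol : V -> V -> bool).
Hypothesis B_I0 : forall x, B x \subset I0.
Hypothesis B_big : forall x, p <= #|B x|.
Hypothesis vcolP : forall x, {in B x &, forall i j, i != j -> c (x, i) (x, j) = vcol x}.
Hypothesis ecolP : forall x y, near e x y -> x != y ->
  {in B x & B y, forall i j, c (x, i) (y, j) = ecol x y}.

(** Keeping the colour [b] of the large class as a parameter lets one argument serve both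
    majorities. A tree of [r]-edges in [W] carries the bags of [H1] directly, since cliques over [W]
    and pairs in [r] all have colour [b]; otherwise [H2] goes onto stars. *)
Lemma host_arrows_oriented (b : bool) (H1 H2 : sgraph) par1 t1 bag1 par2 t2 bag2 :
  L ^ p.*2 * ((L + p.*2) * m) <= #|[set x in V0 | vcol x == b]| ->
  t1 <= n -> tree_partition [set: H1] par1 t1 bag1 -> rooted_tree par1 t1 D ->
  (forall i, #|[set x | bag1 x == i]| <= p) ->
  t2 <= n -> tree_partition [set: H2] par2 t2 bag2 -> rooted_tree par2 t2 D ->
  (forall i, #|[set x | bag2 x == i]| <= p) ->
  has_mono_copy chi (colour_of b) H1 \/ has_mono_copy chi (colour_of (~~ b)) H2.
Proof.
set W := [set x in V0 | _] => Wbig t1n [t10 par1_lt bag1_lt _ bag1_edge] tree1 size1.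
move=> t2n [t20 par2_lt bag2_lt _ bag2_edge] tree2 size2.
have csym u v : c u v = c v u by rewrite /c setUC.
have /choice[el elP] := fun x => nat_indexing p0 (B_big x).
have elB x i : i < p -> el x i \in B x by case: (elP x) => + _; apply.
have elI x i : i < p -> el x i \in I0 by move=> ip; rewrite (subsetP (B_I0 x)) ?elB.
have el_inj x i j : i < p -> j < p -> el x i = el x j -> i = j by case: (elP x) => _; apply.
have ecolC x y : near e x y -> x != y -> ecol x y = ecol y x.
  move=> nxy xy; rewrite -(ecolP nxy xy (elB x 0 p0) (elB y 0 p0)) csym.
  by rewrite (ecolP _ _ (elB y 0 p0) (elB x 0 p0)) 1?near_sym 1?eq_sym.
pose r x y := [&& near e x y, x != y & ecol x y == b].
have rsym : symmetric r.
  apply: symmetric_from_pre => x y /and3P[nxy xy /eqP ec].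
  by rewrite /r (near_sym esym) nxy eq_sym xy -(ecolC x y) ?ec ?eqxx.
have WV0 : W \subset V0 by apply/subsetP=> x; rewrite inE => /andP[].
have [rk1 [rk1_lt rk1_inj]] := bag_rank size1.
have [rk2 [rk2_lt rk2_inj]] := bag_rank size2.
have neq_edge (H : sgraph) (x y : H) : edge x y -> x <> y.
  by move=> exy xy; rewrite xy edge_irrefl in exy.
have mono (H : sgraph) (a : bool) (F : H -> V * I) : injective F ->
    (forall x y : H, edge x y -> host_edge e I0 (F x) (F y) /\ c (F x) (F y) = a) ->
    has_mono_copy chi (colour_of a) H.
  move=> Finj FP; exists (F : H -> G); first by split=> // x y /FP[].
  by move=> x y /FP[_ <-]; rewrite /c is_redK.
have [[f [fW finj fr]]|[g [gW ginj gP]]] :=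
  tree_copy_or_blowup esym rsym nm no_hole WV0 Wbig t20 t2n tree2 t10 t1n tree1.
- left; pose F x := (f (bag1 x), el (f (bag1 x)) (rk1 x)).
  have bag1_lt' x : bag1 x < t1 by apply: bag1_lt; rewrite inE.
  apply: (mono _ _ F).
    move=> x y [] /(finj _ _ (bag1_lt' x) (bag1_lt' y)) bxy; rewrite bxy.
    by move=> /(el_inj _ _ _ (rk1_lt x) (rk1_lt y)); apply: rk1_inj.
  move=> x y exy; have lxy := bag1_edge x y (in_setT x) (in_setT y) exy.
  have [bxy|bxy] := eqVneq (bag1 x) (bag1 y).
    have rxy : el (f (bag1 y)) (rk1 x) != el (f (bag1 y)) (rk1 y).
      apply/eqP => /(el_inj _ _ _ (rk1_lt x) (rk1_lt y)) rxy.
      by apply: (neq_edge _ _ _ exy); apply: rk1_inj.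
    rewrite /F bxy; split.
      rewrite /host_edge /= near_refl !elI //= !andbT.
      by apply: contra rxy => /eqP[->].
    rewrite vcolP ?elB //; have := fW (bag1 y) (bag1_lt' y).
    by rewrite inE => /andP[_ /eqP].
  have /and3P[nF neF /eqP eF] : r (f (bag1 x)) (f (bag1 y)).
    case/or3P: lxy => [bxy'|/andP[j0 /eqP <-]|/andP[j0 /eqP <-]].
    - by rewrite bxy' in bxy.
    - by rewrite fr // j0 bag1_lt'.
    - by rewrite rsym fr // j0 bag1_lt'.
  split; last by rewrite /F ecolP ?elB.
  rewrite /host_edge /= nF !elI //= !andbT.
  by apply: contra neF => /eqP[-> _].
right; have [lev levP] := tree_levels par2_lt.
have bag2_lt' x : bag2 x < t2 by apply: bag2_lt; rewrite inE.
(* A slot is a leaf of the star at the node: [p] leaves for each parity of the depth, so that the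
   ends of every edge of [H2] get leaves in different sets, where near pairs avoid colour [b]. *)
pose slot x := rk2 x + lev (bag2 x) * p.
have slot_lt x : slot x < p.*2.
  by rewrite /slot; have := rk2_lt x; case: (lev _); clear; lia.
have slot_inj x y : bag2 x = bag2 y -> slot x = slot y -> x = y.
  by move=> bxy; rewrite /slot bxy => /addIn; apply: rk2_inj.
(* Distinct vertices of [H2] use distinct leaves, so a single element of each blown-up leaf is
   enough. *)
pose F x := (g (bag2 x) (slot x), el (g (bag2 x) (slot x)) 0).
apply: (mono _ _ F).
  by move=> x y [] /ginj[] // bxy sxy _; apply: slot_inj.
move=> x y exy; have lxy := bag2_edge x y (in_setT x) (in_setT y) exy.
have sxy : slot x != slot y.
  case/or3P: lxy => [/eqP bxy|/andP[j0 /eqP pj]|/andP[j0 /eqP pj]].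
  - by apply/eqP => /(slot_inj _ _ bxy) /(neq_edge _ _ _ exy).
  - have := levP (bag2 y); rewrite /slot -pj j0 bag2_lt' => /(_ isT) ->.
    by have := rk2_lt x; have := rk2_lt y; case: (lev _); clear; lia.
  - have := levP (bag2 x); rewrite /slot -pj j0 bag2_lt' => /(_ isT) ->.
    by have := rk2_lt x; have := rk2_lt y; case: (lev _); clear; lia.
have [nF neF nrF] := gP _ _ _ _ (bag2_lt' x) (bag2_lt' y) (slot_lt x) (slot_lt y) sxy lxy.
split.
  rewrite /host_edge /= nF !elI //= !andbT.
  by apply: contra neF => /eqP[-> _].
rewrite ecolP ?elB //; apply/eqP; move: nrF; rewrite /r nF neF /=.
by case: (ecol _ _); case: (b).
Qed.
End Arrowing.

Theorem theorem1p2 (k d : nat) (hk : 1 <= k) (hd : 1 <= d) :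
  exists c : nat, forall n : nat, 1 <= n ->
  exists G : sgraph, [/\ #|G| = c * n, max_degree G <= c &
    forall H1 H2 : sgraph,
      #|H1| = n -> max_degree H1 <= d -> treewidth H1 <= k ->
      #|H2| = n -> max_degree H2 <= d -> treewidth H2 <= k ->
      forall chi : colouring G,
        has_mono_copy chi Red H1 \/ has_mono_copy chi Blue H2].
Proof.
pose p := 18 * k.+1 * d; pose D := 6 * d; pose q := p.*2; pose L := D.*2 + 6.
have p0 : 0 < p by rewrite /p !muln_gt0.
have L0 : 0 < L by rewrite /L addn_gt0 orbT.
(* [M * m] is the class size that [host_arrows_oriented] requires. The factor 4 pays twice for a
   half: [V0] against all vertices, and the majority colour within [V0]. *)
pose M := L ^ q * (L + q); pose K := 4 * M.
have K0 : 0 < K by rewrite /K /M !muln_gt0 expn_gt0 L0 addn_gt0 L0.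
have [Delta expanderP] := expander K0.
pose b := Delta.+1 ^ 3; pose s := 4 ^ tower p b.*2.
have b0 : 0 < b by rewrite /b expn_gt0.
(* The host has [K * n.*2] base vertices, each replaced by [b * s] vertices, and its degree is at
   most [b * s]. *)
exists (2 * K * (b * s)) => n n0.
have m0 : 0 < n.*2 by rewrite double_gt0.
have [e [V0 [esym _ V0big eD no_hole]]] := expanderP n.*2 m0.
pose I0 := [set i : 'I_(b * s) | i < s].
have cI0 : #|I0| = s.
  have sb : s <= b * s by rewrite leq_pmull.
  have widen_inj : injective (widen_ord sb) by move=> i j /(congr1 val) /= ij; apply: val_inj.
  rewrite -[RHS]card_ord -(card_imset _ widen_inj); apply: eq_card => i; rewrite inE.
  apply/idP/imsetP => [si|[j _ ->]]; last exact: (ltn_ord j).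
  by exists (Ordinal si) => //; apply: val_inj.
exists (host e I0); split.
- by rewrite card_host !card_ord -!mul2n; clear; lia.
- apply: leq_trans (max_degree_host I0 esym eD) _.
  by rewrite cI0 leq_pmull // muln_gt0.
move=> H1 H2 cH1 degH1 twH1 cH2 degH2 twH2 chi.
have [par1 [t1 [bag1 [t1n part1 tree1 size1]]]] : exists par t bag,
    [/\ t <= #|H1|, tree_partition [set: H1] par t bag, rooted_tree par t D &
        forall i, #|[set x | bag x == i]| <= p].
  by apply: bounded_tree_partition; rewrite ?cH1.
have [par2 [t2 [bag2 [t2n part2 tree2 size2]]]] : exists par t bag,
    [/\ t <= #|H2|, tree_partition [set: H2] par t bag, rooted_tree par t D &
        forall i, #|[set x | bag x == i]| <= p].
  by apply: bounded_tree_partition; rewrite ?cH2.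
rewrite cH1 in t1n; rewrite cH2 in t2n.
pose c (x y : 'I_(K * n.*2) * 'I_(b * s)) := is_red (chi [set (x : host e I0); (y : host e I0)]).
have csym : symmetric c by move=> x y; rewrite /c setUC.
have near_le x : #|[set y | near e x y]| <= b by apply: card_near.
have I0big : 4 ^ tower p b.*2 <= #|I0| by rewrite cI0.
have [B [vcol [ecol [B_I0 B_big vcolP ecolP]]]] :=
  homogeneous_blowup csym (near_sym esym) near_le I0big.
have [red|blue] : M * n.*2 <= #|[set x in V0 | vcol x == true]| \/
    M * n.*2 <= #|[set x in V0 | vcol x == false]|.
  have := cardsID [set x | vcol x] V0.
  have -> : V0 :&: [set x | vcol x] = [set x in V0 | vcol x == true].
    by apply/setP=> x; rewrite !inE; case: (vcol x).
  have -> : V0 :\: [set x | vcol x] = [set x in V0 | vcol x == false].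
    by apply/setP=> x; rewrite !inE andbC; case: (vcol x).
  have : 4 * (M * n.*2) <= #|V0|.*2 by rewrite mulnA.
  set x := M * _; set y := #|[set x in V0 | vcol x == true]|.
  move=> V0_ge V0_eq; case: (leqP x y) => [|xy]; [by left|right].
  by move: xy V0_ge V0_eq; card_lia.
- by apply: (host_arrows_oriented esym p0 (leqnn _) no_hole B_I0 B_big vcolP ecolP
    (b := true) _ t1n part1 tree1 size1 t2n part2 tree2 size2); rewrite mulnA.
apply/or_comm.
by apply: (host_arrows_oriented esym p0 (leqnn _) no_hole B_I0 B_big vcolP ecolP
    (b := false) _ t2n part2 tree2 size2 t1n part1 tree1 size1); rewrite mulnA.
Qed.
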